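(* Let $\rho=(r_n)_n$ be an increasing sequence in $[0,1)$ with $r_n\to 1$. For any sequence $(\gamma_k)_k$ of positive real numbers with $\limsup_k\gamma_k^{1/k}\le1$, there exists $f(z)=\sum_{k=0}^\infty a_kz^k$ in $\mathcal{U}_A(\mathbb{D},\rho)$ with $|a_k|\ge\gamma_k$ for every $k$ large enough. In particular, there exist Abel universal functions without Hadamard–Ostrowski gaps.
   Context: $\mathbb{D}$ is the open unit disc, $\mathbb{T}$ the unit circle. For $f\in H(\mathbb{D})$, $f_r(z):=f(rz)$; $\mathcal{U}_A(\mathbb{D},\rho)$ is the set of $f\in H(\mathbb{D})$ such that for every compact $K\subset\mathbb{T}$, $K\neq\mathbb{T}$, and every continuous $\varphi$ on $K$ there is an increasing sequence $(n_k)$ with $\sup_{\zeta\in K}|f_{r_{n_k}}(\zeta)-\varphi(\zeta)|\to0$. Abel universal functions are the elements of $\mathcal{U}_A(\mathbb{D})=\bigcup_\rho\mathcal{U}_A(\mathbb{D},\rho)$. A power series $\sum_k a_kz^k$ with radius of convergence $1$ has Hadamard–Ostrowski gaps if there are sequences $(p_k),(q_k)$ in $\mathbb{N}$ with $1\le p_1<q_1\le p_2<q_2\le\cdots$ and $\inf_k q_k/p_k>1$ such that $\limsup_{k\in I,k\to\infty}|a_k|^{1/k}<1$, where $I=\bigcup_k\{p_k+1,\dots,q_k\}$. *)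

(* Defs.v *)
From Stdlib Require Import Reals List.
From Coquelicot Require Import Coquelicot.
Open Scope R_scope.

Definition circle (z : C) : Prop := Cmod z = 1.

Definition compactC (K : C -> Prop) : Prop :=
  forall (I : Type) (U : I -> C -> Prop),
    (forall i, open (U i)) ->
    (forall z, K z -> exists i, U i z) ->
    exists l : list I, forall z, K z -> exists i, In i l /\ U i z.

Definition continuous_on (K : C -> Prop) (phi : C -> C) : Prop :=
  forall z, K z -> forall eps, 0 < eps -> exists delta, 0 < delta /\
    forall w, K w -> Cmod (w - z)%C < delta -> Cmod (phi w - phi z)%C < eps.

Definition admissible_radii (r : nat -> R) : Prop :=
  (forall n, 0 <= r n < 1) /\ (forall n, r n < r (S n)) /\ is_lim_seq r 1.

Definition taylor_on_disc (a : nat -> C) (f : C -> C) : Prop :=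
  forall z : C, Cmod z < 1 -> is_series (fun k => (a k * pow_n z k)%C) (f z).

Definition dil (f : C -> C) (r : R) : C -> C := fun z => f (RtoC r * z)%C.

(* U_A(D, rho) (membership condition, f being holomorphic on D). *)
Definition abel_universal_rho (r : nat -> R) (f : C -> C) : Prop :=
  forall (K : C -> Prop) (phi : C -> C),
    (forall z, K z -> circle z) -> compactC K -> (exists z, circle z /\ ~ K z) ->
    continuous_on K phi ->
    exists nk : nat -> nat, (forall k, nk k < nk (S k))%nat /\
      forall eps, 0 < eps -> exists N, forall k, (N <= k)%nat ->
        forall zeta, K zeta -> Cmod (dil f (r (nk k)) zeta - phi zeta)%C <= eps.

Definition abel_universal (a : nat -> C) (f : C -> C) : Prop :=
  taylor_on_disc a f /\ exists r, admissible_radii r /\ abel_universal_rho r f.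

Definition kroot (x : R) (k : nat) : R :=
  if Req_EM_T x 0 then 0 else Rpower x (/ INR k).

Definition radius_one (a : nat -> C) : Prop :=
  (forall z : C, Cmod z < 1 -> ex_series (fun k => (a k * pow_n z k)%C)) /\
  (forall z : C, 1 < Cmod z -> ~ ex_series (fun k => (a k * pow_n z k)%C)).

Definition HO_gaps (a : nat -> C) : Prop :=
  radius_one a /\
  exists p q : nat -> nat,
    (1 <= p 0)%nat /\ (forall k, p k < q k /\ q k <= p (S k))%nat /\
    (exists c, 1 < c /\ forall k, c <= INR (q k) / INR (p k)) /\
    (exists c, c < 1 /\ exists N, forall n, (N <= n)%nat ->
        (exists k, p k < n <= q k)%nat -> kroot (Cmod (a n)) n <= c).

(* Main.v *)
Require Import Defs.
From Stdlib Require Import Reals List Lra Lia Wf_nat ClassicalEpsilon.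
From Stdlib Require Cantor.
From mathcomp Require choice.
From Coquelicot Require Import Coquelicot.
Open Scope R_scope.

(** The coefficients are built block by block. Given a gap point z0 of the circle and an arc K
    avoiding z0, three ingredients are added beyond a large degree N.  (1) By Runge's theorem
    (pushing poles through the gap), polynomials that are small on a disc |z| <= s' and close to
    1 on R K: multiplying by the target and dropping the low degrees gives h, of order > N, with
    |h_k| <= lam^k for lam = 1/s' as close to 1 as desired, and correcting the value on R K.
    (2) With w = z/z0, the polynomial b = 1 + c (w + ... + w^L) has nonnegative coefficients,
    b(0) = 1, and |b| <= q < 1 on R K for small c, since w/(1-w) has real part -1/2 on the circle.
    Hence p = sum_j g_j w^j b^(e_j) with g_j = gamma_j + |h_j| has coefficients p_j >= g_j, yet it
    is small on R K when q^(e_j) beats g_j, and small on a smaller disc |z| <= s as long as e_j is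
    a small multiple of j; both are possible because gamma is subexponential.  (3) A tail of
    the series of gamma_k w^k, starting so late that it is small at radius R.
    Iterating over a countable dense family of (K, target polynomial) and approximating continuous
    functions on K by polynomials (Bernstein, in a Cayley coordinate) yields universality. *)

(** Lower bounds on coefficients and smallness on R K are compatible because K misses z0: with
    nonnegative coefficients in w, the polynomial p is largest at positive w, which is the direction
    of the gap. The phases of the coefficients of h are unknown; putting |h_j| into g_j is what
    keeps |h_j + p_j z0^(-j)| >= gamma_j whatever they are. The order of choices avoids a circle.
    The contraction factor q and the bound of b on |z| <= s depend only on s and the width of the
    gap, although the degree L of b depends on R. So lam and N are fixed first, then R > 1/lam as h
    requires, then h and b, and last the degree D where the tail (3) starts. The tail makes the new
    coefficients have modulus gamma_k from some point on. The next step may therefore discard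
    everything beyond its own N: what is lost is subexponential, hence negligible on |z| <= s.
    Taking for s the radius R of the preceding step protects all approximations already achieved. *)

(** * Finite sums and elementary estimates *)

Fixpoint csum (u : nat -> C) (n : nat) : C :=
  match n with O => RtoC 0 | S m => (csum u m + u m)%C end.

Fixpoint rsum (u : nat -> R) (n : nat) : R :=
  match n with O => 0 | S m => rsum u m + u m end.

Lemma csum_ext (u v : nat -> C) (n : nat) :
  (forall k, (k < n)%nat -> u k = v k) -> csum u n = csum v n.
Proof.
  induction n as [|n IH]; intros H; simpl; [reflexivity|].
  rewrite IH by (intros; apply H; lia). now rewrite H by lia.
Qed.

Lemma csum_plus (u v : nat -> C) (n : nat) :
  csum (fun k => (u k + v k)%C) n = (csum u n + csum v n)%C.
Proof. induction n as [|n IH]; simpl; [ring|]. rewrite IH; ring. Qed.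

Lemma csum_scal (a : C) (u : nat -> C) (n : nat) :
  csum (fun k => (a * u k)%C) n = (a * csum u n)%C.
Proof. induction n as [|n IH]; simpl; [ring|]. rewrite IH; ring. Qed.

Lemma csum_head (u : nat -> C) (n : nat) :
  csum u (S n) = (u O + csum (fun k => u (S k)) n)%C.
Proof.
  induction n as [|n IH]; [simpl; ring|].
  change (csum u (S (S n))) with (csum u (S n) + u (S n))%C.
  rewrite IH. simpl. ring.
Qed.

Lemma csum_stable (u : nat -> C) (m n : nat) :
  (m <= n)%nat -> (forall k, (m <= k < n)%nat -> u k = RtoC 0) -> csum u n = csum u m.
Proof.
  induction 1 as [|n Hmn IH]; intros H; [reflexivity|]. simpl.
  rewrite IH by (intros; apply H; lia). rewrite H by lia. ring.
Qed.

Lemma rsum_le (u v : nat -> R) (n : nat) :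
  (forall k, (k < n)%nat -> u k <= v k) -> rsum u n <= rsum v n.
Proof.
  induction n as [|n IH]; intros H; simpl; [lra|].
  apply Rplus_le_compat; [apply IH; intros; apply H; lia | apply H; lia].
Qed.

Lemma rsum_ext (u v : nat -> R) (n : nat) :
  (forall k, (k < n)%nat -> u k = v k) -> rsum u n = rsum v n.
Proof. intros H; apply Rle_antisym; apply rsum_le; intros; rewrite H by easy; lra. Qed.

Lemma rsum_plus (u v : nat -> R) (n : nat) :
  rsum (fun k => u k + v k) n = rsum u n + rsum v n.
Proof. induction n as [|n IH]; simpl; [ring|]. rewrite IH; ring. Qed.

Lemma rsum_scal (a : R) (u : nat -> R) (n : nat) :
  rsum (fun k => a * u k) n = a * rsum u n.
Proof. induction n as [|n IH]; simpl; [ring|]. rewrite IH; ring. Qed.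

Lemma rsum_head (u : nat -> R) (n : nat) :
  rsum u (S n) = u O + rsum (fun k => u (S k)) n.
Proof.
  induction n as [|n IH]; [simpl; ring|].
  change (rsum u (S (S n))) with (rsum u (S n) + u (S n)).
  rewrite IH. simpl. ring.
Qed.

Lemma rsum_pos (u : nat -> R) (n : nat) : (forall k, 0 <= u k) -> 0 <= rsum u n.
Proof. intros H; induction n as [|n IH]; simpl; [lra|]. specialize (H n); lra. Qed.

Lemma rsum_term_le (u : nat -> R) (n k : nat) :
  (forall k, 0 <= u k) -> (k < n)%nat -> u k <= rsum u n.
Proof.
  intros H; induction n as [|n IH]; intros Hk; [lia|]. simpl.
  pose proof (H n). pose proof (rsum_pos u n H).
  destruct (Nat.eq_dec k n) as [->|]; [lra|]. assert (u k <= rsum u n) by (apply IH; lia). lra.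
Qed.

Lemma Cmod_csum (u : nat -> C) (n : nat) :
  Cmod (csum u n) <= rsum (fun k => Cmod (u k)) n.
Proof.
  induction n as [|n IH]; simpl; [rewrite Cmod_0; lra|].
  eapply Rle_trans; [apply Cmod_triangle|]. lra.
Qed.

(** Tails are handled through partial sums starting at 0 with vanishing initial terms. The bound is
    uniform in [n], which is the form in which smallness on a disc is carried through the
    construction. *)
Lemma rsum_tail_geometric (u : nat -> R) (c x : R) (N n : nat) :
  0 <= c -> 0 <= x < 1 ->
  (forall k, (k < N)%nat -> u k = 0) -> (forall k, (N <= k)%nat -> u k <= c * x ^ k) ->
  rsum u n <= c * x ^ N / (1 - x).
Proof.
  intros Hc Hx H0 H1.
  assert (HN : 0 <= c * x ^ N / (1 - x)).
  { apply Rdiv_le_0_compat; [|lra]. apply Rmult_le_pos; [lra|apply pow_le; lra]. }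
  assert (E : forall m, rsum u (N + m) <= c * (x ^ N - x ^ (N + m)) / (1 - x)).
  { induction m as [|m IH].
    - rewrite Nat.add_0_r. replace (rsum u N) with 0.
      + right; field; lra.
      + symmetry; transitivity (rsum (fun _ => 0) N).
        * apply rsum_ext; intros; now apply H0.
        * clear. induction N as [|N IH]; simpl; lra.
    - replace (N + S m)%nat with (S (N + m)) by lia. simpl.
      specialize (H1 (N + m)%nat ltac:(lia)).
      replace (c * (x ^ N - x * x ^ (N + m)) / (1 - x))
        with (c * (x ^ N - x ^ (N + m)) / (1 - x) + c * x ^ (N + m)) by (field; lra). lra. }
  destruct (Nat.le_gt_cases N n) as [Hn|Hn].
  - replace n with (N + (n - N))%nat by lia. eapply Rle_trans; [apply E|].
    apply Rmult_le_compat_r; [left; apply Rinv_0_lt_compat; lra|].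
    apply Rmult_le_compat_l; [lra|]. assert (0 <= x ^ (N + (n - N))) by (apply pow_le; lra). lra.
  - replace (rsum u n) with 0; [lra|].
    transitivity (rsum (fun _ => 0) n).
    + clear. induction n as [|n IH]; simpl; lra.
    + apply rsum_ext; intros; symmetry; apply H0; lia.
Qed.

Lemma pow_eventually_small (x eps : R) : 0 <= x < 1 -> 0 < eps ->
  exists N, forall n, (N <= n)%nat -> x ^ n <= eps.
Proof.
  intros Hx He. destruct (pow_lt_1_zero x ltac:(rewrite Rabs_pos_eq; lra) eps He) as [N HN].
  exists N; intros n Hn. specialize (HN n Hn). apply Rabs_def2 in HN. lra.
Qed.

Lemma Cmod_minus_sym (x y : C) : Cmod (x - y)%C = Cmod (y - x)%C.
Proof. replace (x - y)%C with (- (y - x))%C by ring. apply Cmod_opp. Qed.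

Lemma Cmod_sub_ge (x y : C) : Cmod x - Cmod y <= Cmod (x - y)%C.
Proof.
  pose proof (Cmod_triangle (x - y) y). replace (x - y + y)%C with x in H by ring. lra.
Qed.

Lemma Cmod_add_ge (x y : C) : Cmod x - Cmod y <= Cmod (x + y)%C.
Proof.
  replace (x + y)%C with (x - - y)%C by ring. rewrite <- (Cmod_opp y). apply Cmod_sub_ge.
Qed.

Lemma Cmod_eq_nz (x : C) : 0 < Cmod x -> x <> RtoC 0.
Proof. intros H E. rewrite E, Cmod_0 in H. lra. Qed.

(** * Polynomials as coefficient lists *)

Fixpoint eval (l : list C) (z : C) : C :=
  match l with nil => RtoC 0 | a :: l => (a + z * eval l z)%C end.

(** The weighted Wiener norm, the sum of |a_k| s^k. It is submultiplicative, so it controls powers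
    of a polynomial, and it bounds at once the values on |z| <= s and the coefficients. *)
Fixpoint nrm (l : list C) (s : R) : R :=
  match l with nil => 0 | a :: l => Cmod a + s * nrm l s end.

Definition coef (l : list C) (k : nat) : C := nth k l (RtoC 0).

Fixpoint padd (l m : list C) : list C :=
  match l, m with
  | nil, m => m
  | l, nil => l
  | a :: l, b :: m => (a + b)%C :: padd l m
  end.

Definition pscal (c : C) (l : list C) : list C := map (Cmult c) l.

Fixpoint pmul (l m : list C) : list C :=
  match l with nil => nil | a :: l => padd (pscal a m) (RtoC 0 :: pmul l m) end.

Lemma eval_padd l m z : eval (padd l m) z = (eval l z + eval m z)%C.
Proof.
  revert m; induction l as [|a l IH]; intros [|b m]; simpl; try ring.
  rewrite IH; ring.
Qed.

Lemma eval_pscal c l z : eval (pscal c l) z = (c * eval l z)%C.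
Proof.
  unfold pscal; induction l as [|a l IH]; simpl; [ring|]. rewrite IH. ring.
Qed.

Lemma eval_pmul l m z : eval (pmul l m) z = (eval l z * eval m z)%C.
Proof.
  induction l as [|a l IH]; simpl; [ring|].
  rewrite eval_padd, eval_pscal. simpl. rewrite IH. ring.
Qed.

Lemma nrm_ge0 l s : 0 <= s -> 0 <= nrm l s.
Proof.
  intros Hs; induction l as [|a l IH]; simpl; [lra|].
  pose proof (Cmod_ge_0 a). nra.
Qed.

Lemma nrm_padd l m s : 0 <= s -> nrm (padd l m) s <= nrm l s + nrm m s.
Proof.
  intros Hs; revert m; induction l as [|a l IH]; intros [|b m]; simpl; try lra.
  specialize (IH m). pose proof (Cmod_triangle a b). nra.
Qed.

Lemma nrm_pscal c l s : nrm (pscal c l) s = Cmod c * nrm l s.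
Proof.
  unfold pscal; induction l as [|a l IH]; simpl; [ring|]. rewrite IH, Cmod_mult. ring.
Qed.

Lemma nrm_pmul l m s : 0 <= s -> nrm (pmul l m) s <= nrm l s * nrm m s.
Proof.
  intros Hs; induction l as [|a l IH]; simpl; [lra|].
  eapply Rle_trans; [now apply nrm_padd|]. rewrite nrm_pscal. simpl. rewrite Cmod_0. nra.
Qed.

Lemma eval_coef l n z : (length l <= n)%nat ->
  eval l z = csum (fun k => (coef l k * z ^ k)%C) n.
Proof.
  revert n; induction l as [|a l IH]; intros n Hn; simpl in *.
  - symmetry. rewrite (csum_stable _ 0 n); [reflexivity|lia|].
    intros [|k] _; unfold coef; simpl; ring.
  - destruct n as [|n]; [lia|]. rewrite csum_head, (IH n) by lia.
    rewrite <- csum_scal. unfold coef at 2; simpl.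
    f_equal; [ring|]. apply csum_ext; intros k _. unfold coef. simpl. ring.
Qed.

Lemma coef_overflow l k : (length l <= k)%nat -> coef l k = RtoC 0.
Proof. apply nth_overflow. Qed.

Lemma coef_sum_le_nrm l s n : 0 <= s -> rsum (fun k => Cmod (coef l k) * s ^ k) n <= nrm l s.
Proof.
  intros Hs. revert n; induction l as [|a l IH]; intros n.
  - simpl. induction n as [|n IHn]; simpl; [lra|].
    rewrite (coef_overflow nil n) by (simpl; lia). rewrite Cmod_0. lra.
  - destruct n as [|n]; [now apply (nrm_ge0 (a :: l))|].
    rewrite rsum_head. unfold coef at 1; simpl.
    rewrite (rsum_ext _ (fun k => s * (Cmod (coef l k) * s ^ k))).
    + rewrite rsum_scal. specialize (IH n). nra.
    + intros k _. unfold coef; simpl. ring.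
Qed.

Lemma Cmod_eval_le_nrm l z s : Cmod z <= s -> Cmod (eval l z) <= nrm l s.
Proof.
  intros Hz. pose proof (Cmod_ge_0 z).
  induction l as [|a l IH]; simpl; [rewrite Cmod_0; lra|].
  eapply Rle_trans; [apply Cmod_triangle|]. rewrite Cmod_mult.
  pose proof (Cmod_ge_0 (eval l z)). nra.
Qed.

Lemma coef_padd l m k : coef (padd l m) k = (coef l k + coef m k)%C.
Proof.
  unfold coef; revert m k; induction l as [|a l IH]; intros [|b m] [|k]; simpl; try ring.
  apply IH.
Qed.

Lemma coef_pscal c l k : coef (pscal c l) k = (c * coef l k)%C.
Proof.
  unfold coef, pscal. replace (RtoC 0) with (c * RtoC 0)%C at 1 by ring. apply map_nth.
Qed.

(** * Polynomials with nonnegative coefficients *)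

Definition nonneg (x : C) : Prop := Im x = 0 /\ 0 <= Re x.

Definition pnonneg (l : list C) : Prop := forall k, nonneg (coef l k).

Lemma nonneg_0 : nonneg (RtoC 0).
Proof. split; simpl; lra. Qed.

Lemma nonneg_plus x y : nonneg x -> nonneg y -> nonneg (x + y)%C.
Proof. unfold nonneg; destruct x, y; simpl; lra. Qed.

Lemma nonneg_mult x y : nonneg x -> nonneg y -> nonneg (x * y)%C.
Proof. unfold nonneg; destruct x, y; simpl; intros [-> ?] [-> ?]; split; nra. Qed.

Lemma nonneg_Cmod x : nonneg x -> Cmod x = Re x.
Proof.
  intros [H1 H2]. destruct x as [a b]; simpl in *; subst b.
  change (a, 0) with (RtoC a). rewrite Cmod_R. now apply Rabs_pos_eq.
Qed.

Lemma pnonneg_cons a l : nonneg a -> pnonneg l -> pnonneg (a :: l).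
Proof. intros Ha Hl [|k]; [exact Ha|apply Hl]. Qed.

Lemma pnonneg_padd l m : pnonneg l -> pnonneg m -> pnonneg (padd l m).
Proof. intros Hl Hm k. rewrite coef_padd. now apply nonneg_plus. Qed.

Lemma pnonneg_pscal c l : nonneg c -> pnonneg l -> pnonneg (pscal c l).
Proof. intros Hc Hl k. rewrite coef_pscal. now apply nonneg_mult. Qed.

Lemma pnonneg_pmul l m : pnonneg l -> pnonneg m -> pnonneg (pmul l m).
Proof.
  intros Hl Hm; induction l as [|a l IH]; [exact Hl|].
  apply pnonneg_padd; [apply pnonneg_pscal; [apply (Hl O)|exact Hm]|].
  apply pnonneg_cons; [apply nonneg_0|]. apply IH. intros k; apply (Hl (S k)).
Qed.

Fixpoint ppow (l : list C) (n : nat) : list C :=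
  match n with O => RtoC 1 :: nil | S n => pmul l (ppow l n) end.

Lemma eval_ppow l n z : eval (ppow l n) z = (eval l z ^ n)%C.
Proof. induction n as [|n IH]; simpl; [ring|]. now rewrite eval_pmul, IH. Qed.

Lemma nrm_ppow l n s : 0 <= s -> nrm (ppow l n) s <= nrm l s ^ n.
Proof.
  intros Hs; induction n as [|n IH]; simpl; [rewrite Cmod_1; lra|].
  eapply Rle_trans; [now apply nrm_pmul|].
  apply Rmult_le_compat_l; [now apply nrm_ge0|exact IH].
Qed.

Lemma pnonneg_ppow l n : pnonneg l -> pnonneg (ppow l n).
Proof.
  intros Hl; induction n as [|n IH]; simpl; [|now apply pnonneg_pmul].
  apply pnonneg_cons; [split; simpl; lra|]. intros [|k]; apply nonneg_0.
Qed.

Lemma coef0_pmul l m : coef (pmul l m) 0 = (coef l 0 * coef m 0)%C.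
Proof.
  destruct l as [|a l]; [unfold coef; simpl; ring|].
  simpl. rewrite coef_padd, coef_pscal. unfold coef; simpl. ring.
Qed.

Lemma coef0_ppow l n : coef l 0 = RtoC 1 -> coef (ppow l n) 0 = RtoC 1.
Proof.
  intros H; induction n as [|n IH]; [reflexivity|]. simpl.
  rewrite coef0_pmul, H, IH. ring.
Qed.

Definition pshift (n : nat) (l : list C) : list C := repeat (RtoC 0) n ++ l.

Lemma eval_pshift n l z : eval (pshift n l) z = (z ^ n * eval l z)%C.
Proof.
  unfold pshift; induction n as [|n IH]; simpl; [ring|]. rewrite IH; ring.
Qed.

Lemma nrm_pshift n l s : nrm (pshift n l) s = s ^ n * nrm l s.
Proof.
  unfold pshift; induction n as [|n IH]; simpl; [ring|]. rewrite IH, Cmod_0; ring.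
Qed.

Lemma coef_pshift n l k :
  coef (pshift n l) k = if (k <? n)%nat then RtoC 0 else coef l (k - n).
Proof.
  unfold coef, pshift. destruct (Nat.ltb_spec k n) as [H|H].
  - rewrite app_nth1 by (now rewrite repeat_length). apply nth_repeat.
  - rewrite app_nth2; rewrite repeat_length; [reflexivity|exact H].
Qed.

(** * Polynomial functions *)

Definition polynomial (F : C -> C) : Prop := exists l, forall z, F z = eval l z.

Lemma polynomial_const c : polynomial (fun _ => c).
Proof. exists (c :: nil); intros z; simpl; ring. Qed.

Lemma polynomial_id : polynomial (fun z => z).
Proof. exists (RtoC 0 :: RtoC 1 :: nil); intros z; simpl; ring. Qed.

Lemma polynomial_plus F G : polynomial F -> polynomial G -> polynomial (fun z => F z + G z)%C.
Proof.
  intros [l Hl] [m Hm]; exists (padd l m); intros z. now rewrite eval_padd, Hl, Hm.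
Qed.

Lemma polynomial_mult F G : polynomial F -> polynomial G -> polynomial (fun z => F z * G z)%C.
Proof.
  intros [l Hl] [m Hm]; exists (pmul l m); intros z. now rewrite eval_pmul, Hl, Hm.
Qed.

Lemma polynomial_ext F G : (forall z, F z = G z) -> polynomial F -> polynomial G.
Proof. intros E [l Hl]; exists l; intros z. now rewrite <- E. Qed.

Lemma polynomial_minus F G : polynomial F -> polynomial G -> polynomial (fun z => F z - G z)%C.
Proof.
  intros HF HG. apply polynomial_ext with (fun z => F z + (- RtoC 1) * G z)%C.
  - intros; ring.
  - apply polynomial_plus; [exact HF|]. apply polynomial_mult; [apply polynomial_const|exact HG].
Qed.

Lemma polynomial_pow F n : polynomial F -> polynomial (fun z => F z ^ n)%C.
Proof.
  intros HF; induction n as [|n IH]; simpl; [apply polynomial_const|now apply polynomial_mult].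
Qed.

(** * Cauchy estimates *)

Definition cis (t : R) : C := (cos t, sin t).

Lemma cis_plus a b : cis (a + b) = (cis a * cis b)%C.
Proof. unfold cis, Cmult; simpl. rewrite cos_plus, sin_plus. f_equal; ring. Qed.

Lemma Cmod_cis a : Cmod (cis a) = 1.
Proof.
  unfold Cmod, cis; simpl. replace (cos a * (cos a * 1) + sin a * (sin a * 1)) with 1.
  - apply sqrt_1.
  - pose proof (sin2_cos2 a) as H; unfold Rsqr in H; lra.
Qed.

Lemma cis_PI : cis PI = (- RtoC 1)%C.
Proof. unfold cis, Copp, RtoC; simpl. rewrite cos_PI, sin_PI. f_equal; ring. Qed.

Lemma cis_0 : cis 0 = RtoC 1.
Proof. unfold cis. now rewrite cos_0, sin_0. Qed.

Fixpoint evens (l : list C) : list C :=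
  match l with nil => nil | a :: m => a :: match m with nil => nil | _ :: m' => evens m' end end.

Definition odds (l : list C) : list C := evens (tl l).

Lemma list_ind2 (P : list C -> Prop) :
  P nil -> (forall a, P (a :: nil)) -> (forall a b l, P l -> P (a :: b :: l)) -> forall l, P l.
Proof.
  intros H0 H1 H2. fix IH 1. intros [|a [|b l]]; [exact H0|apply H1|apply H2, IH].
Qed.

Lemma eval_even_odd l z : eval l z = (eval (evens l) (z * z) + z * eval (odds l) (z * z))%C.
Proof.
  unfold odds; induction l as [|a|a b l IH] using list_ind2; simpl; [ring|ring|].
  rewrite IH. destruct l as [|c l]; simpl; ring.
Qed.

Lemma coef_evens l k : coef l (2 * k) = coef (evens l) k.
Proof.
  unfold coef; revert k; induction l as [|a|a b l IH] using list_ind2; intros k.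
  - now destruct k.
  - destruct k as [|[|k]]; reflexivity.
  - destruct k as [|k]; [reflexivity|]. replace (2 * S k)%nat with (S (S (2 * k))) by lia.
    apply IH.
Qed.

Lemma coef_odds l k : coef l (S (2 * k)) = coef (odds l) k.
Proof.
  unfold odds. rewrite <- coef_evens. destruct l as [|a l]; [|reflexivity].
  unfold coef. now destruct (2 * k)%nat.
Qed.

Lemma length_evens l : (2 * length (evens l) <= S (length l))%nat.
Proof.
  induction l as [|a|a b l IH] using list_ind2; simpl in *; lia.
Qed.

(* Averaging over z and -z bounds the even and odd parts, whose degrees are halved. *)
Lemma cauchy_estimate l s B : 0 < s ->
  (forall t, Cmod (eval l (RtoC s * cis t)%C) <= B) -> forall k, Cmod (coef l k) * s ^ k <= B.
Proof.
  remember (length l) as n eqn:En. revert l En s B.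
  induction n as [n IH] using lt_wf_ind. intros l En s B Hs HB k.
  assert (HB0 : 0 <= B) by (eapply Rle_trans; [apply Cmod_ge_0|apply (HB 0)]).
  destruct l as [|a [|b l]].
  - rewrite coef_overflow by (simpl; lia). rewrite Cmod_0; lra.
  - destruct k as [|k].
    + specialize (HB 0). simpl in HB.
      replace (a + RtoC s * cis 0 * RtoC 0)%C with a in HB by ring.
      unfold coef; simpl. lra.
    + rewrite coef_overflow by (simpl; lia). rewrite Cmod_0; lra.
  - set (p := a :: b :: l) in *.
    assert (Hss : RtoC s <> RtoC 0) by (intros E; apply RtoC_inj in E; lra).
    (* The square roots of s^2 cis t are s cis (t/2) and its negative s cis (t/2 + PI). Both lie on
       the original circle, so [B] bounds the polynomial at both; half the sum gives the even part,
       half the difference z times the odd part, whence the bound B / s for the latter. *)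
    assert (Hsq : forall t, (RtoC s * cis (t / 2) * (RtoC s * cis (t / 2)))%C
                            = (RtoC (s * s) * cis t)%C).
    { intros t. replace t with (t / 2 + t / 2) at 3 by field. rewrite cis_plus, RtoC_mult. ring. }
    assert (Hneg : forall t, (RtoC s * cis (t / 2 + PI))%C = (- (RtoC s * cis (t / 2)))%C).
    { intros t. rewrite cis_plus, cis_PI. ring. }
    assert (Hsq' : forall t, (- (RtoC s * cis (t / 2)) * - (RtoC s * cis (t / 2)))%C
                            = (RtoC (s * s) * cis t)%C) by (intros t; rewrite <- Hsq; ring).
    assert (HE : forall t, Cmod (eval (evens p) (RtoC (s * s) * cis t)%C) <= B).
    { intros t. pose proof (HB (t / 2)) as H1. pose proof (HB (t / 2 + PI)) as H2.
      rewrite Hneg in H2. rewrite eval_even_odd, Hsq in H1. rewrite eval_even_odd, Hsq' in H2.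
      set (E := eval (evens p) _) in *. set (O := eval (odds p) _) in *.
      pose proof (Cmod_triangle (E + RtoC s * cis (t / 2) * O) (E + - (RtoC s * cis (t / 2)) * O)) as H.
      match type of H with Cmod ?x <= _ => replace x with (RtoC 2 * E)%C in H by ring end.
      rewrite Cmod_mult, Cmod_R, Rabs_pos_eq in H by lra. lra. }
    assert (HO : forall t, Cmod (eval (odds p) (RtoC (s * s) * cis t)%C) <= B / s).
    { intros t. pose proof (HB (t / 2)) as H1. pose proof (HB (t / 2 + PI)) as H2.
      rewrite Hneg in H2. rewrite eval_even_odd, Hsq in H1. rewrite eval_even_odd, Hsq' in H2.
      set (E := eval (evens p) _) in *. set (O := eval (odds p) _) in *.
      pose proof (Cmod_triangle (E + RtoC s * cis (t / 2) * O) (- (E + - (RtoC s * cis (t / 2)) * O))) as H.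
      match type of H with Cmod ?x <= _ =>
        replace x with (RtoC 2 * (RtoC s * cis (t / 2) * O))%C in H by ring end.
      rewrite Cmod_opp, !Cmod_mult, !Cmod_R, Cmod_cis, !Rabs_pos_eq in H by lra.
      apply Rle_div_r; lra. }
    assert (Lp : length p = S (S (length l))) by reflexivity.
    destruct (Nat.Even_or_Odd k) as [[j ->]|[j ->]].
    + rewrite coef_evens. rewrite pow_mult. replace (s ^ 2) with (s * s) by ring.
      apply (IH (length (evens p))); try easy; try nra.
      pose proof (length_evens p). lia.
    + replace (2 * j + 1)%nat with (S (2 * j)) by lia.
      rewrite coef_odds, <- tech_pow_Rmult, pow_mult. replace (s ^ 2) with (s * s) by ring.
      assert (Cmod (coef (odds p) j) * (s * s) ^ j <= B / s).
      { apply (IH (length (odds p))); try easy; try nra.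
        pose proof (length_evens (tl p)). unfold odds; simpl in *; lia. }
      apply Rle_div_r in H; lra.
Qed.

(** * Approximate inverses and Runge's theorem *)

(** A relative form of uniform approximation of 1/a by polynomials on X. Free of division, it passes
    to products without lower bounds on |a|. *)
Definition approx_inv (X : C -> Prop) (a : C -> C) : Prop :=
  forall eps, 0 < eps ->
    exists P, polynomial P /\ forall z, X z -> Cmod (RtoC 1 - a z * P z)%C <= eps.

(* Neumann series: one approximate inverse with error below 1 yields arbitrarily good ones. *)
Lemma approx_inv_of_contraction (X : C -> Prop) (a P : C -> C) (rho : R) :
  polynomial a -> polynomial P -> 0 <= rho < 1 ->
  (forall z, X z -> Cmod (RtoC 1 - a z * P z)%C <= rho) -> approx_inv X a.
Proof.
  intros Ha HP Hr H eps He.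
  destruct (pow_eventually_small rho eps Hr He) as [n Hn]. specialize (Hn n (le_n n)).
  assert (HQ : exists Q, polynomial Q /\
    forall z, (RtoC 1 - a z * Q z)%C = ((RtoC 1 - a z * P z) ^ n)%C).
  { clear Hn. induction n as [|n [Q [HQ EQ]]].
    - exists (fun _ => RtoC 0); split; [apply polynomial_const|]. intros; simpl; ring.
    - exists (fun z => P z + (RtoC 1 - a z * P z) * Q z)%C; split.
      + apply polynomial_plus; [exact HP|]. apply polynomial_mult; [|exact HQ].
        apply polynomial_minus; [apply polynomial_const|now apply polynomial_mult].
      + intros z. simpl. rewrite <- EQ. ring. }
  destruct HQ as [Q [HQ EQ]]. exists Q; split; [exact HQ|].
  intros z Hz. rewrite EQ, Cmod_pow. eapply Rle_trans; [|exact Hn].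
  apply pow_incr; split; [apply Cmod_ge_0|now apply H].
Qed.

Lemma approx_inv_mult (X : C -> Prop) (a b : C -> C) :
  approx_inv X a -> approx_inv X b -> approx_inv X (fun z => a z * b z)%C.
Proof.
  intros Ha Hb eps He.
  set (e := Rmin 1 (eps / 3)).
  assert (He1 : 0 < e) by (apply Rmin_pos; lra).
  assert (He2 : e <= 1) by apply Rmin_l. assert (He3 : e <= eps / 3) by apply Rmin_r.
  destruct (Ha e He1) as [P [HP EP]]. destruct (Hb e He1) as [Q [HQ EQ]].
  exists (fun z => P z * Q z)%C; split; [now apply polynomial_mult|]. intros z Hz.
  specialize (EP z Hz). specialize (EQ z Hz).
  set (p := (RtoC 1 - a z * P z)%C) in *. set (q := (RtoC 1 - b z * Q z)%C) in *.
  (* This is 1 - (1 - p)(1 - q); its three terms are each at most e <= eps/3, the product because e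
     <= 1. *)
  replace (RtoC 1 - a z * b z * (P z * Q z))%C with (p + (q - p * q))%C by (unfold p, q; ring).
  pose proof (Cmod_triangle p (q - p * q)). pose proof (Cmod_triangle q (- (p * q))).
  rewrite Cmod_opp, Cmod_mult in H0. pose proof (Cmod_ge_0 p). pose proof (Cmod_ge_0 q).
  unfold Cminus in *. nra.
Qed.

Lemma polynomial_shift p : polynomial (fun z => z - p)%C.
Proof. apply polynomial_minus; [apply polynomial_id|apply polynomial_const]. Qed.

(** An approximate inverse P of z - p with error 1/4 satisfies |P| <= 5/(4d) on X. Used for p' it
    has error at most 1/4 + (d/2) 5/(4d) = 7/8, and the Neumann series does the rest. *)
Lemma approx_inv_move_pole (X : C -> Prop) (p p' : C) (d : R) :
  0 < d -> (forall z, X z -> d <= Cmod (z - p)%C) -> Cmod (p' - p)%C <= d / 2 ->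
  approx_inv X (fun z => z - p)%C -> approx_inv X (fun z => z - p')%C.
Proof.
  intros Hd HX Hp Hinv. destruct (Hinv (1 / 4) ltac:(lra)) as [P [HP EP]].
  apply approx_inv_of_contraction with P (7 / 8); [apply polynomial_shift|exact HP|lra|].
  intros z Hz. specialize (EP z Hz). specialize (HX z Hz).
  replace (RtoC 1 - (z - p') * P z)%C with ((RtoC 1 - (z - p) * P z) + (p' - p) * P z)%C by ring.
  eapply Rle_trans; [apply Cmod_triangle|]. rewrite Cmod_mult.
  assert (Hm : Cmod (z - p) * Cmod (P z) <= 5 / 4).
  { rewrite <- Cmod_mult.
    replace ((z - p) * P z)%C with (RtoC 1 - (RtoC 1 - (z - p) * P z))%C by ring.
    unfold Cminus at 1. eapply Rle_trans; [apply Cmod_triangle|]. rewrite Cmod_opp, Cmod_1. lra. }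
  pose proof (Cmod_ge_0 (P z)). pose proof (Cmod_ge_0 (p' - p)%C).
  assert (Cmod (p' - p) * Cmod (P z) <= d / 2 * Cmod (P z)) by (apply Rmult_le_compat_r; lra).
  assert (d * Cmod (P z) <= Cmod (z - p) * Cmod (P z)) by (apply Rmult_le_compat_r; lra).
  lra.
Qed.

(** Pole pushing: the path is cut into n pieces of length at most L/n <= d/2. The distance d to X is
    the same for all pieces, so the step size does not shrink along the way. *)
Lemma approx_inv_along_path (X : C -> Prop) (g : R -> C) (d L : R) :
  0 < d -> 0 <= L ->
  (forall a b, Cmod (g a - g b)%C <= L * Rabs (a - b)) ->
  (forall t z, 0 <= t <= 1 -> X z -> d <= Cmod (z - g t)%C) ->
  approx_inv X (fun z => z - g 0)%C -> approx_inv X (fun z => z - g 1)%C.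
Proof.
  intros Hd HL Hg HX H0.
  destruct (archimed_cor1 (d / 2 / (L + 1)) ltac:(apply Rdiv_lt_0_compat; lra)) as [n [Hn Hn0]].
  assert (Hn1 : 0 < INR n) by (apply lt_0_INR; lia).
  assert (E : forall i, (i <= n)%nat -> approx_inv X (fun z => z - g (INR i / INR n)%R)%C).
  { induction i as [|i IH]; intros Hi.
    - replace (INR 0 / INR n) with 0 by (simpl; field; lra). exact H0.
    - apply approx_inv_move_pole with (g (INR i / INR n)%R) d; [exact Hd| | |apply IH; lia].
      + intros z Hz. apply HX; [|exact Hz]. split.
        * apply Rdiv_le_0_compat; [apply pos_INR|exact Hn1].
        * apply Rle_div_l; [exact Hn1|]. rewrite Rmult_1_l. apply le_INR; lia.
      + eapply Rle_trans; [apply Hg|]. rewrite S_INR.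
        replace ((INR i + 1) / INR n - INR i / INR n) with (/ INR n) by (field; lra).
        rewrite Rabs_pos_eq by (left; now apply Rinv_0_lt_compat).
        apply Rlt_div_r in Hn; [|lra].
        assert (0 < / INR n) by now apply Rinv_0_lt_compat. nra. }
  specialize (E n (le_n n)). replace (INR n / INR n) with 1 in E by (field; lra). exact E.
Qed.

(** The starting point of pole pushing: outside a large disc the constant -1/p is already an
    approximate inverse, with error |z/p| <= 1/4. *)
Lemma approx_inv_far_pole (X : C -> Prop) (p : C) :
  4 <= Cmod p -> (forall z, X z -> Cmod z <= 1) -> approx_inv X (fun z => z - p)%C.
Proof.
  intros Hp HX. assert (Hp0 : p <> RtoC 0) by (apply Cmod_eq_nz; lra).
  apply approx_inv_of_contraction with (fun _ => - / p)%C (1 / 4);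
    [apply polynomial_shift|apply polynomial_const|lra|].
  intros z Hz. replace (RtoC 1 - (z - p) * - / p)%C with (z / p)%C by (field; exact Hp0).
  rewrite Cmod_div by exact Hp0. specialize (HX z Hz).
  apply Rle_div_l; lra.
Qed.

(** The pole enters from 4 z0 along the ray through z0, that is, through the gap. *)
Lemma approx_inv_ray (X : C -> Prop) (z0 : C) (t d : R) :
  Cmod z0 = 1 -> 0 < d -> 0 <= t <= 4 -> (forall z, X z -> Cmod z <= 1) ->
  (forall tau z, t <= tau <= 4 -> X z -> d <= Cmod (z - RtoC tau * z0)%C) ->
  approx_inv X (fun z => z - RtoC t * z0)%C.
Proof.
  intros Hz0 Hd Ht HX1 HX.
  pose (g := fun u : R => (RtoC (4 - u * (4 - t)) * z0)%C).
  assert (H : approx_inv X (fun z => z - g 1)%C).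
  { apply approx_inv_along_path with d (4 - t); [exact Hd|lra| | |].
    - intros a b. unfold g.
      replace (RtoC (4 - a * (4 - t)) * z0 - RtoC (4 - b * (4 - t)) * z0)%C
        with (RtoC ((4 - t) * - (a - b)) * z0)%C
        by (rewrite !RtoC_minus, !RtoC_mult, RtoC_opp, !RtoC_minus; ring).
      rewrite Cmod_mult, Cmod_R, Rabs_mult, Rabs_Ropp, Hz0, (Rabs_pos_eq (4 - t)) by lra. lra.
    - intros u z Hu Hz. apply HX; [|exact Hz]. nra.
    - apply approx_inv_far_pole; [|exact HX1]. unfold g.
      rewrite Cmod_mult, Cmod_R, Hz0, Rabs_pos_eq; lra. }
  unfold g in H. replace (4 - 1 * (4 - t)) with t in H by ring. exact H.
Qed.

Lemma cis_lipschitz a b : Cmod (cis a - cis b)%C <= 2 * Rabs (a - b).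
Proof.
  assert (Hc : Rabs (cos a - cos b) <= Rabs (a - b)).
  { destruct (MVT_gen cos b a (fun x => - sin x)) as [c [_ Hc]].
    - intros x _. auto_derive; [easy|ring].
    - intros x _. apply continuity_cos.
    - rewrite Hc, Rabs_mult, Rabs_Ropp.
      assert (Rabs (sin c) <= 1) by (apply Rabs_le; apply SIN_bound).
      pose proof (Rabs_pos (a - b)). nra. }
  assert (Hs : Rabs (sin a - sin b) <= Rabs (a - b)).
  { destruct (MVT_gen sin b a cos) as [c [_ Hs]].
    - intros x _. auto_derive; [easy|ring].
    - intros x _. apply continuity_sin.
    - rewrite Hs, Rabs_mult.
      assert (Rabs (cos c) <= 1) by (apply Rabs_le; apply COS_bound).
      pose proof (Rabs_pos (a - b)). nra. }
  replace (cis a - cis b)%C with (RtoC (cos a - cos b) + Ci * RtoC (sin a - sin b))%C.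
  - eapply Rle_trans; [apply Cmod_triangle|].
    rewrite Cmod_mult, Cmod_Ci, !Cmod_R. lra.
  - unfold cis, Cminus, Cplus, Copp, Ci, Cmult, RtoC; simpl. f_equal; ring.
Qed.

Lemma approx_inv_rotate (X : C -> Prop) (p : C) (alpha d : R) :
  0 < d -> (forall u z, X z -> d <= Cmod (z - p * cis u)%C) ->
  approx_inv X (fun z => z - p)%C -> approx_inv X (fun z => z - p * cis alpha)%C.
Proof.
  intros Hd HX H0.
  pose (g := fun u : R => (p * cis (u * alpha))%C).
  assert (H : approx_inv X (fun z => z - g 1)%C).
  { apply approx_inv_along_path with d (Cmod p * (2 * Rabs alpha)); [exact Hd| | | |].
    - pose proof (Cmod_ge_0 p). pose proof (Rabs_pos alpha). nra.
    - intros a b. unfold g.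
      replace (p * cis (a * alpha) - p * cis (b * alpha))%C
        with (p * (cis (a * alpha) - cis (b * alpha)))%C by ring.
      rewrite Cmod_mult, Rmult_assoc. apply Rmult_le_compat_l; [apply Cmod_ge_0|].
      eapply Rle_trans; [apply cis_lipschitz|].
      replace (a * alpha - b * alpha) with (alpha * (a - b)) by ring. rewrite Rabs_mult. lra.
    - intros u z _ Hz. now apply HX.
    - unfold g. rewrite Rmult_0_l, cis_0. intros eps He.
      destruct (H0 eps He) as [P [HP EP]]. exists P; split; [exact HP|].
      intros z Hz. replace (z - p * RtoC 1)%C with (z - p)%C by ring. now apply EP. }
  unfold g in H. now rewrite Rmult_1_l in H.
Qed.

Lemma Cpow_mult_dist (x y : C) n : ((x * y) ^ n = x ^ n * y ^ n)%C.
Proof. induction n as [|n IH]; simpl; [ring|]. rewrite IH; ring. Qed.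

Lemma cis_pow a n : (cis a ^ n)%C = cis (INR n * a).
Proof.
  induction n as [|n IH]; [simpl; now rewrite Rmult_0_l, cis_0|].
  rewrite S_INR. replace ((INR n + 1) * a) with (a + INR n * a) by ring.
  rewrite cis_plus, <- IH. reflexivity.
Qed.

Lemma Cpow_double (z : C) n : (z ^ (2 * n) = z ^ n * z ^ n)%C.
Proof. replace (2 * n)%nat with (n + n)%nat by lia. apply Cpow_add_r. Qed.

(* The factorisation z^2n - p^2n = (z^n - p^n) (z^n - (w p)^n), where w^n = -1, reduces
   the exponent 2^m to poles on the circle through p. *)
Lemma approx_inv_pow_minus (X : C -> Prop) (p : C) (d : R) (m : nat) :
  0 < d -> (forall u z, X z -> d <= Cmod (z - p * cis u)%C) ->
  approx_inv X (fun z => z - p)%C -> approx_inv X (fun z => z ^ (2 ^ m) - p ^ (2 ^ m))%C.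
Proof.
  intros Hd HX H0.
  (* The induction covers all points of the circle through p, since each factorisation brings in a
     second one, turned by PI / n so that its n-th power changes sign. *)
  assert (E : forall u, approx_inv X (fun z => z ^ (2 ^ m) - (p * cis u) ^ (2 ^ m))%C).
  { induction m as [|m IH]; intros u.
    - intros eps He. destruct (approx_inv_rotate X p u d Hd HX H0 eps He) as [P [HP EP]].
      exists P; split; [exact HP|]. intros z Hz.
      replace (z ^ (2 ^ 0) - (p * cis u) ^ (2 ^ 0))%C with (z - p * cis u)%C by (simpl; ring).
      now apply EP.
    - set (n := (2 ^ m)%nat) in *.
      assert (Hn : INR n <> 0).
      { apply not_0_INR. unfold n. apply Nat.pow_nonzero; lia. }
      pose proof (approx_inv_mult _ _ _ (IH u) (IH (u + PI / INR n))) as Hm.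
      intros eps He. destruct (Hm eps He) as [P [HP EP]].
      exists P; split; [exact HP|]. intros z Hz. specialize (EP z Hz).
      replace (2 ^ S m)%nat with (2 * n)%nat by (unfold n; simpl; lia).
      rewrite !Cpow_double.
      rewrite !Cpow_mult_dist, (cis_pow (u + _)), Rmult_plus_distr_l in EP.
      replace (INR n * (PI / INR n)) with PI in EP by (field; exact Hn).
      rewrite cis_plus, cis_PI, <- cis_pow in EP. rewrite !Cpow_mult_dist.
      match type of EP with Cmod ?x <= _ => match goal with |- Cmod ?y <= _ =>
        replace y with x by ring end end. exact EP. }
  intros eps He. destruct (E 0 eps He) as [P [HP EP]]. exists P; split; [exact HP|].
  intros z Hz. specialize (EP z Hz). rewrite cis_0 in EP.
  replace (p * RtoC 1)%C with p in EP by ring. exact EP.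
Qed.

(** * Runge approximation on a disc and an arc *)

Definition arc (z0 : C) (delta : R) (z : C) : Prop := Cmod z = 1 /\ delta <= Cmod (z - z0)%C.

(** The distance is at least |R0 - tau| and at least R0 delta - |R0 - tau|; these two bounds add up
    to R0 delta, so the larger is at least half of it. *)
Lemma dist_to_ray (z0 zeta : C) (R0 tau delta : R) :
  Cmod z0 = 1 -> Cmod zeta = 1 -> 0 <= R0 -> 0 <= tau -> delta <= Cmod (zeta - z0)%C ->
  R0 * delta / 2 <= Cmod (RtoC R0 * zeta - RtoC tau * z0)%C.
Proof.
  intros H0 H1 HR Ht Hd.
  assert (A : Rabs (R0 - tau) <= Cmod (RtoC R0 * zeta - RtoC tau * z0)).
  { pose proof (Cmod_sub_ge (RtoC R0 * zeta) (RtoC tau * z0)) as H.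
    pose proof (Cmod_sub_ge (RtoC tau * z0) (RtoC R0 * zeta)) as H'.
    rewrite (Cmod_minus_sym (RtoC tau * z0)) in H'.
    rewrite !Cmod_mult, !Cmod_R, H0, H1, !Rabs_pos_eq in H, H' by lra.
    apply Rabs_le. lra. }
  assert (B : R0 * delta - Rabs (R0 - tau) <= Cmod (RtoC R0 * zeta - RtoC tau * z0)).
  { replace (RtoC R0 * zeta - RtoC tau * z0)%C
      with (RtoC R0 * (zeta - z0) + RtoC (R0 - tau) * z0)%C by (rewrite RtoC_minus; ring).
    eapply Rle_trans; [|apply Cmod_add_ge].
    rewrite !Cmod_mult, !Cmod_R, H0, (Rabs_pos_eq R0) by lra. nra. }
  pose proof (Rabs_pos (R0 - tau)). lra.
Qed.

(* With p in the gap direction, s < |p| < R, and Q an approximate inverse of z^n - p^n,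
   n = 2^m large, the polynomial 1 + p^n Q is close to 0 on the disc and to 1 on the arc. *)
Lemma runge_disc_arc (z0 : C) (delta s R0 eps : R) :
  Cmod z0 = 1 -> 0 < delta <= 1 -> 0 < s < R0 -> R0 <= 1 -> 0 < eps ->
  exists P, polynomial P /\ (forall z, Cmod z <= s -> Cmod (P z) <= eps) /\
    (forall zeta, arc z0 delta zeta -> Cmod (P (RtoC R0 * zeta) - RtoC 1)%C <= eps).
Proof.
  intros Hz0 Hdel Hs HR He.
  set (t := (s + R0) / 2).
  set (X := fun z : C => Cmod z <= s \/ exists zeta, arc z0 delta zeta /\ z = (RtoC R0 * zeta)%C).
  set (d := Rmin ((R0 - s) / 2) (R0 * delta / 2)).
  assert (Hd1 : d <= (R0 - s) / 2) by apply Rmin_l.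
  assert (Hd2 : d <= R0 * delta / 2) by apply Rmin_r.
  assert (Hd : 0 < d) by (apply Rmin_pos; [lra|]; assert (0 < R0 * delta) by nra; lra).
  assert (HX1 : forall z, X z -> Cmod z <= 1).
  { intros z [Hz|[zeta [[Hz _] ->]]]; [lra|].
    rewrite Cmod_mult, Cmod_R, Hz, Rabs_pos_eq; lra. }
  assert (Hray : approx_inv X (fun z => z - RtoC t * z0)%C).
  { apply approx_inv_ray with d; [exact Hz0|exact Hd|unfold t; lra|exact HX1|].
    intros tau z Htau [Hz|[zeta [[Hz1 Hz2] ->]]].
    - rewrite Cmod_minus_sym. eapply Rle_trans; [|apply Cmod_sub_ge].
      rewrite Cmod_mult, Cmod_R, Hz0, Rabs_pos_eq by (unfold t in *; lra). unfold t in *; lra.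
    - eapply Rle_trans; [exact Hd2|]. apply dist_to_ray; trivial; unfold t in *; lra. }
  assert (Hp : Cmod (RtoC t * z0) = t)
    by (rewrite Cmod_mult, Cmod_R, Hz0, Rabs_pos_eq; unfold t; lra).
  set (p := (RtoC t * z0)%C) in *.
  (* The circle through p separates the disc from the arc, so the pole can turn around it freely;
     only the radial approach had to use the gap. *)
  assert (Hcirc : forall u z, X z -> d <= Cmod (z - p * cis u)%C).
  { intros u z [Hz|[zeta [[Hz1 Hz2] ->]]].
    - rewrite Cmod_minus_sym. eapply Rle_trans; [|apply Cmod_sub_ge].
      rewrite Cmod_mult, Cmod_cis, Hp. unfold t in *; lra.
    - eapply Rle_trans; [|apply Cmod_sub_ge].
      rewrite !Cmod_mult, Cmod_cis, Hp, Cmod_R, Hz1, Rabs_pos_eq by lra. unfold t in *; lra. }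
  (* Both estimates below end with |F| (1 - e) <= 2e, so |F| <= 8e/3 <= eps. *)
  set (e := Rmin (1 / 4) (eps / 4)).
  assert (He1 : 0 < e) by (apply Rmin_pos; lra).
  assert (He2 : e <= 1 / 4) by apply Rmin_l. assert (He3 : e <= eps / 4) by apply Rmin_r.
  assert (Ht : 0 < t) by (unfold t; lra).
  assert (Hr1 : 0 <= s / t < 1).
  { split; [apply Rdiv_le_0_compat; lra|]. apply Rlt_div_l; [lra|]. unfold t; lra. }
  assert (Hr2 : 0 <= t / R0 < 1).
  { split; [apply Rdiv_le_0_compat; lra|]. apply Rlt_div_l; [lra|]. unfold t; lra. }
  destruct (pow_eventually_small _ e Hr1 He1) as [n1 Hn1].
  destruct (pow_eventually_small _ e Hr2 He1) as [n2 Hn2].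
  set (m := (n1 + n2)%nat). set (n := (2 ^ m)%nat).
  assert (Hmn : (m < n)%nat) by (apply Nat.pow_gt_lin_r; lia).
  specialize (Hn1 n ltac:(lia)). specialize (Hn2 n ltac:(lia)).
  destruct (approx_inv_pow_minus X p d m Hd Hcirc Hray e He1) as [Q [HQ EQ]]. fold n in EQ.
  assert (Hpn : (p ^ n)%C <> RtoC 0) by (apply Cpow_nz, Cmod_eq_nz; lra).
  (* With the exact inverse in place of Q this is z^n / (z^n - p^n), which for large n is close to 0
     inside the circle |z| = t and close to 1 outside. The two identities [EF] account for the error
     v of Q. *)
  exists (fun z => RtoC 1 + p ^ n * Q z)%C; split; [|split].
  - apply polynomial_plus; [apply polynomial_const|].
    apply polynomial_mult; [apply polynomial_const|exact HQ].
  - intros z Hz. specialize (EQ z (or_introl Hz)).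
    set (v := (RtoC 1 - (z ^ n - p ^ n) * Q z)%C) in *.
    assert (Hrho : Cmod (z ^ n / p ^ n) <= e).
    { rewrite Cmod_div, !Cmod_pow, Hp by exact Hpn. eapply Rle_trans; [|exact Hn1].
      unfold Rdiv. rewrite Rpow_mult_distr, pow_inv.
      apply Rmult_le_compat_r; [left; apply Rinv_0_lt_compat, pow_lt; lra|].
      apply pow_incr; split; [apply Cmod_ge_0|exact Hz]. }
    set (rho := (z ^ n / p ^ n)%C) in *. set (F := (RtoC 1 + p ^ n * Q z)%C).
    assert (EF : (F * (RtoC 1 - rho))%C = (v - rho)%C)
      by (unfold F, v, rho; field; exact Hpn).
    assert (H1 : Cmod F * Cmod (RtoC 1 - rho) <= 2 * e).
    { rewrite <- Cmod_mult, EF. unfold Cminus. eapply Rle_trans; [apply Cmod_triangle|].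
      rewrite Cmod_opp. lra. }
    pose proof (Cmod_sub_ge (RtoC 1) rho) as H2. rewrite Cmod_1 in H2.
    pose proof (Cmod_ge_0 F). nra.
  - intros zeta Hzeta.
    assert (Hz : X (RtoC R0 * zeta)%C) by (right; now exists zeta).
    specialize (EQ _ Hz). destruct Hzeta as [Hz1 _]. set (z := (RtoC R0 * zeta)%C) in *.
    set (v := (RtoC 1 - (z ^ n - p ^ n) * Q z)%C) in *.
    assert (Hzm : Cmod z = R0) by (unfold z; rewrite Cmod_mult, Cmod_R, Hz1, Rabs_pos_eq; lra).
    assert (Hzn : (z ^ n)%C <> RtoC 0) by (apply Cpow_nz, Cmod_eq_nz; lra).
    assert (Hrho : Cmod (p ^ n / z ^ n) <= e).
    { rewrite Cmod_div, !Cmod_pow, Hp, Hzm by exact Hzn. eapply Rle_trans; [|exact Hn2].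
      unfold Rdiv. rewrite Rpow_mult_distr, pow_inv. lra. }
    set (rho := (p ^ n / z ^ n)%C) in *. set (F := (RtoC 1 + p ^ n * Q z - RtoC 1)%C).
    assert (EF : (F * (RtoC 1 - rho))%C = (rho * (RtoC 1 - v))%C)
      by (unfold F, v, rho; field; exact Hzn).
    assert (H1 : Cmod F * Cmod (RtoC 1 - rho) <= 2 * e).
    { rewrite <- Cmod_mult, EF, Cmod_mult.
      assert (Cmod (RtoC 1 - v) <= 2).
      { unfold Cminus. eapply Rle_trans; [apply Cmod_triangle|]. rewrite Cmod_opp, Cmod_1. lra. }
      pose proof (Cmod_ge_0 rho). pose proof (Cmod_ge_0 (RtoC 1 - v)). nra. }
    pose proof (Cmod_sub_ge (RtoC 1) rho) as H2. rewrite Cmod_1 in H2.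
    pose proof (Cmod_ge_0 F). nra.
Qed.

(** * Polynomials with large coefficients, small on the disc and on the arc *)

Lemma eval_repeat (c w : C) (n : nat) :
  ((RtoC 1 - w) * eval (repeat c n) w)%C = (c * (RtoC 1 - w ^ n))%C.
Proof.
  induction n as [|n IH]; simpl; [ring|].
  transitivity ((RtoC 1 - w) * c + w * ((RtoC 1 - w) * eval (repeat c n) w))%C; [ring|].
  rewrite IH; ring.
Qed.

Lemma nrm_repeat (c s : R) (n : nat) : 0 <= c -> 0 <= s < 1 ->
  nrm (repeat (RtoC c) n) s <= c / (1 - s).
Proof.
  intros Hc Hs. assert (E : (1 - s) * nrm (repeat (RtoC c) n) s = c * (1 - s ^ n)).
  { induction n as [|n IH]; simpl; [ring|].
    rewrite Cmod_R, Rabs_pos_eq by lra.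
    transitivity ((1 - s) * c + s * ((1 - s) * nrm (repeat (RtoC c) n) s)); [ring|].
    rewrite IH; ring. }
  apply Rle_div_r; [lra|]. rewrite Rmult_comm, E. assert (0 <= s ^ n) by (apply pow_le; lra). nra.
Qed.

Lemma Cmod_sqr (x : C) : Cmod x * Cmod x = Re x * Re x + Im x * Im x.
Proof.
  pose proof (Cmod2_alt x) as H. simpl in H. lra.
Qed.

(* |1 - (1-c) w|^2 = (1-c) |1-w|^2 + c (1-|w|^2) + c^2 |w|^2, so for small c the function
   1 + c w / (1 - w) = (1 - (1-c) w) / (1 - w) is a contraction near the arc. *)
Lemma Mobius_contraction (w : C) (d c : R) :
  0 < d <= 1 -> c = d * d / 4 -> Cmod w <= 1 -> 1 - Cmod w * Cmod w <= d * d / 4 ->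
  d <= Cmod (RtoC 1 - w)%C ->
  Cmod (RtoC 1 - RtoC (1 - c) * w)%C <= (1 - c / 4) * Cmod (RtoC 1 - w)%C.
Proof.
  intros Hd -> Hw1 Hw2 Hw3. set (c := d * d / 4) in *.
  assert (Hc : 0 < c <= 1 / 4) by (unfold c; split; nra).
  pose proof (Cmod_ge_0 (RtoC 1 - w)) as P. pose proof (Cmod_ge_0 w) as Pw.
  apply Rsqr_incr_0; [|apply Cmod_ge_0|nra]. unfold Rsqr.
  set (D := Cmod (RtoC 1 - w)) in *.
  assert (E : Cmod (RtoC 1 - RtoC (1 - c) * w) * Cmod (RtoC 1 - RtoC (1 - c) * w)
              = (1 - c) * (D * D) + c * (1 - Cmod w * Cmod w) + c * c * (Cmod w * Cmod w)).
  { unfold D. rewrite !Cmod_sqr. destruct w as [x y]; simpl. ring. }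
  rewrite E. assert (HD : d * d <= D * D) by nra.
  set (rho := Cmod w * Cmod w) in *.
  assert (Hrho : 0 <= rho <= 1) by (unfold rho; nra).
  assert (HcD : c <= D * D / 4) by (unfold c; lra).
  (* Each of the last two terms of [E] costs at most c D^2 / 4, which leaves (1 - c/2) D^2 <= (1 -
     c/4)^2 D^2. *)
  assert (c * (1 - rho) <= c * (D * D / 4)) by (apply Rmult_le_compat_l; lra).
  assert (c * c * rho <= c * (D * D / 4)).
  { rewrite Rmult_assoc. apply Rmult_le_compat_l; [lra|]. nra. }
  assert (0 <= c * c * (D * D)) by (apply Rmult_le_pos; nra). nra.
Qed.

(** b is the truncation of 1 + c w / (1 - w) after w^L, and (1 - w) b = 1 - (1 - c) w - c w^(L+1).
    With R0^(L+1) <= d/8 the truncation spoils only half of the gain c/4. The length L depends on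
    R0, but neither the norm bound nor the factor 1 - c/8 does, so they may be used before R0 is
    chosen. *)
Lemma arc_contraction_polynomial (d R0 c : R) :
  0 < d <= 1 -> c = d * d / 4 -> 0 <= R0 < 1 -> 1 - R0 * R0 <= d * d / 4 ->
  exists b, pnonneg b /\ coef b 0 = RtoC 1 /\
    (forall s, 0 <= s < 1 -> nrm b s <= 1 + c / (1 - s)) /\
    (forall w, Cmod w = R0 -> d <= Cmod (RtoC 1 - w)%C -> Cmod (eval b w) <= 1 - c / 8).
Proof.
  intros Hd Ec HR HR2. assert (Hc : 0 < c <= 1 / 4) by (rewrite Ec; nra).
  destruct (pow_eventually_small R0 (d / 8) HR ltac:(lra)) as [L HL].
  specialize (HL (S L) ltac:(lia)).
  exists (RtoC 1 :: repeat (RtoC c) L); split; [|split; [|split]].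
  - apply pnonneg_cons; [split; simpl; lra|]. intros k. unfold coef.
    destruct (Nat.lt_ge_cases k L) as [H|H].
    + rewrite (nth_indep _ _ (RtoC c)) by (now rewrite repeat_length).
      rewrite nth_repeat. split; simpl; lra.
    + rewrite nth_overflow by (now rewrite repeat_length). apply nonneg_0.
  - reflexivity.
  - intros s Hs. simpl. rewrite Cmod_1. pose proof (nrm_repeat c s L ltac:(lra) Hs) as H.
    pose proof (nrm_ge0 (repeat (RtoC c) L) s ltac:(lra)). nra.
  - intros w Hw Hd1.
    pose proof (Mobius_contraction w d c Hd Ec ltac:(lra) ltac:(now rewrite Hw) Hd1) as HM.
    set (D := Cmod (RtoC 1 - w)) in *.
    assert (E : ((RtoC 1 - w) * eval (RtoC 1 :: repeat (RtoC c) L) w)%C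
                = (RtoC 1 - RtoC (1 - c) * w + - (RtoC c * w ^ S L))%C).
    { simpl. transitivity (RtoC 1 - w + w * ((RtoC 1 - w) * eval (repeat (RtoC c) L) w))%C; [ring|].
      rewrite eval_repeat, RtoC_minus. ring. }
    assert (H : D * Cmod (eval (RtoC 1 :: repeat (RtoC c) L) w) <= D * (1 - c / 8)).
    { unfold D at 1. rewrite <- Cmod_mult, E. eapply Rle_trans; [apply Cmod_triangle|].
      rewrite Cmod_opp, Cmod_mult, Cmod_pow, Hw, Cmod_R, Rabs_pos_eq by lra.
      assert (c * R0 ^ S L <= c * (d / 8)) by (apply Rmult_le_compat_l; lra). nra. }
    apply Rmult_le_reg_l in H; lra.
Qed.

(** Degree by degree, g_j w^j b^(e_j) is added. Since b(0) = 1 its lowest coefficient is exactly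
    g_j, and as all coefficients are nonnegative no later summand can diminish it. *)
Lemma large_coef_polynomial (b : list C) (N : nat) (g : nat -> R) (e : nat -> nat)
  (X : C -> Prop) (s B q C1 C2 x y : R) :
  pnonneg b -> coef b 0 = RtoC 1 -> 0 <= s -> nrm b s <= B ->
  (forall w, X w -> Cmod w <= 1 /\ Cmod (eval b w) <= q) ->
  (forall j, 0 <= g j) ->
  (forall j, (N < j)%nat -> g j * s ^ j * B ^ e j <= C1 * x ^ j) ->
  (forall j, (N < j)%nat -> g j * q ^ e j <= C2 * y ^ j) ->
  forall D, exists l, pnonneg l /\ (forall k, (k <= N)%nat -> coef l k = RtoC 0) /\
    (forall k, (N < k <= D)%nat -> g k <= Re (coef l k)) /\
    nrm l s <= rsum (fun j => if (j <=? N)%nat then 0 else C1 * x ^ j) (S D) /\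
    (forall w, X w ->
      Cmod (eval l w) <= rsum (fun j => if (j <=? N)%nat then 0 else C2 * y ^ j) (S D)).
Proof.
  intros Hb Hb0 Hs HB HX Hg H1 H2.
  assert (Hbs : 0 <= nrm b s) by now apply nrm_ge0.
  assert (Z : forall n, (n <= N)%nat -> forall f, rsum (fun j => if (j <=? N)%nat then 0 else f j) (S n) = 0).
  { intros n Hn f. transitivity (rsum (fun _ => 0) (S n)).
    - apply rsum_ext. intros k Hk. destruct (Nat.leb_spec k N); [reflexivity|lia].
    - clear. induction n as [|n IH]; simpl in *; lra. }
  induction D as [|D IH].
  - exists nil. rewrite !Z by lia. split; [|split; [|split; [|split]]].
    + intros [|k]; apply nonneg_0.
    + intros [|k] _; reflexivity.
    + intros; lia.
    + simpl; lra.
    + intros; simpl; rewrite Cmod_0; lra.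
  - destruct IH as [l [I1 [I2 [I3 [I4 I5]]]]].
    destruct (Nat.le_gt_cases (S D) N) as [HD|HD].
    { exists l. rewrite !Z by lia. rewrite !Z in I4 by lia.
      split; [exact I1|]. split; [exact I2|]. split; [intros; lia|]. split; [exact I4|].
      intros w Hw. specialize (I5 w Hw). now rewrite Z in I5 by lia. }
    set (t := pscal (RtoC (g (S D))) (pshift (S D) (ppow b (e (S D))))).
    assert (Ht : pnonneg t).
    { apply pnonneg_pscal; [split; simpl; [reflexivity|apply Hg]|].
      intros k. rewrite coef_pshift. destruct (Nat.ltb_spec k (S D)); [apply nonneg_0|].
      now apply pnonneg_ppow. }
    assert (Ht0 : forall k, (k < S D)%nat -> coef t k = RtoC 0).
    { intros k Hk. unfold t. rewrite coef_pscal, coef_pshift.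
      destruct (Nat.ltb_spec k (S D)); [ring|lia]. }
    assert (Ht1 : coef t (S D) = RtoC (g (S D))).
    { unfold t. rewrite coef_pscal, coef_pshift, Nat.ltb_irrefl, Nat.sub_diag.
      rewrite coef0_ppow by exact Hb0. ring. }
    exists (padd l t). split; [|split; [|split; [|split]]].
    + now apply pnonneg_padd.
    + intros k Hk. rewrite coef_padd, I2, Ht0 by lia. ring.
    + intros k Hk. rewrite coef_padd. change (Re (coef l k + coef t k)%C)
        with (Re (coef l k) + Re (coef t k)).
      destruct (Nat.eq_dec k (S D)) as [->|Hne].
      * rewrite Ht1. change (Re (RtoC (g (S D)))) with (g (S D)).
        destruct (I1 (S D)). lra.
      * destruct (Ht k). specialize (I3 k ltac:(lia)). lra.
    + eapply Rle_trans; [now apply nrm_padd|].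
      change (rsum ?f (S (S D))) with (rsum f (S D) + f (S D)). cbv beta.
      destruct (Nat.leb_spec (S D) N); [lia|]. apply Rplus_le_compat; [exact I4|].
      eapply Rle_trans; [|apply H1; lia]. unfold t.
      rewrite nrm_pscal, nrm_pshift, Cmod_R, Rabs_pos_eq by apply Hg.
      rewrite Rmult_assoc. apply Rmult_le_compat_l; [apply Hg|].
      apply Rmult_le_compat_l; [now apply pow_le|].
      eapply Rle_trans; [now apply nrm_ppow|]. apply pow_incr; lra.
    + intros w Hw. rewrite eval_padd. eapply Rle_trans; [apply Cmod_triangle|].
      change (rsum ?f (S (S D))) with (rsum f (S D) + f (S D)). cbv beta.
      destruct (Nat.leb_spec (S D) N); [lia|]. apply Rplus_le_compat; [now apply I5|].
      eapply Rle_trans; [|apply H2; lia]. unfold t. destruct (HX w Hw) as [Hw1 Hw2].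
      rewrite eval_pscal, eval_pshift, eval_ppow, !Cmod_mult, !Cmod_pow, Cmod_R,
        Rabs_pos_eq by apply Hg.
      apply Rmult_le_compat_l; [apply Hg|].
      assert (Cmod w ^ S D <= 1) by (rewrite <- (pow1 (S D)); apply pow_incr; split; [apply Cmod_ge_0|exact Hw1]).
      assert (0 <= Cmod (eval b w) ^ e (S D) <= q ^ e (S D)).
      { split; [apply pow_le, Cmod_ge_0|apply pow_incr; split; [apply Cmod_ge_0|exact Hw2]]. }
      nra.
Qed.

(** The rates for exponents e_j close to j/m: B^(e_j) then costs about mu^j, and q^(e_j) gains
    lam^(-2j), enough to absorb coefficients of size lam^j and leave lam^(-j). The choice mu =
    2/(1+s) gives mu^2 s = 4s/(1+s)^2 < 1, and lam is the smaller of mu and the 2m-th root of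
    1/q. *)
Lemma exists_growth_rates (s B q : R) : 0 <= s < 1 -> 0 < q < 1 ->
  exists (mu lam : R) (m : nat), 1 < lam <= mu /\ mu * mu * s < 1 /\ (0 < m)%nat /\
    B <= mu ^ m /\ lam ^ (2 * m) * q <= 1.
Proof.
  intros Hs Hq. set (mu := 2 / (1 + s)).
  assert (Hmu : 1 < mu) by (unfold mu; apply Rlt_div_r; lra).
  assert (Hmus : mu * mu * s < 1).
  { unfold mu. replace (2 / (1 + s) * (2 / (1 + s)) * s)
      with (4 * s / ((1 + s) * (1 + s))) by (field; lra).
    apply Rlt_div_l; nra. }
  destruct (Pow_x_infinity mu ltac:(rewrite Rabs_pos_eq; lra) B) as [m0 Hm0].
  set (m := S m0). specialize (Hm0 m ltac:(unfold m; lia)).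
  rewrite Rabs_pos_eq in Hm0 by (apply pow_le; lra).
  assert (Hm : 0 < INR (2 * m)) by (apply lt_0_INR; unfold m; lia).
  set (la := Rpower (/ q) (/ INR (2 * m))).
  assert (Hq' : 1 < / q) by (rewrite <- Rinv_1; apply Rinv_lt_contravar; lra).
  assert (Hla : 1 < la).
  { unfold la. rewrite <- (Rpower_O (/ q)) by lra. apply Rpower_lt; [lra|].
    now apply Rinv_0_lt_compat. }
  assert (Hlam : la ^ (2 * m) = / q).
  { unfold la. rewrite <- Rpower_pow by (apply exp_pos). rewrite Rpower_mult, Rinv_l by lra.
    apply Rpower_1. lra. }
  exists mu, (Rmin mu la), m. repeat split; trivial.
  - now apply Rmin_glb_lt.
  - apply Rmin_l.
  - unfold m; lia.
  - lra.
  - assert (Rmin mu la ^ (2 * m) <= / q).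
    { rewrite <- Hlam. apply pow_incr; split; [|apply Rmin_r]. left; apply Rmin_pos; lra. }
    apply Rmult_le_reg_r with (/ q); [lra|].
    rewrite Rmult_assoc, Rinv_r by lra. lra.
Qed.

Lemma polynomial_comp_scal (l : list C) (c : C) : polynomial (fun z => eval l (c * z)%C).
Proof.
  induction l as [|a l IH]; simpl; [apply polynomial_const|].
  apply polynomial_plus; [apply polynomial_const|].
  apply polynomial_mult; [|exact IH].
  apply polynomial_mult; [apply polynomial_const|apply polynomial_id].
Qed.

Lemma polynomial_csum (a : nat -> C) (n : nat) : polynomial (fun z => csum (fun k => a k * z ^ k)%C n).
Proof.
  induction n as [|n IH]; simpl; [apply polynomial_const|].
  apply polynomial_plus; [exact IH|].
  apply polynomial_mult; [apply polynomial_const|apply polynomial_pow, polynomial_id].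
Qed.

Lemma coef_firstn l n k : coef (firstn n l) k = if (k <? n)%nat then coef l k else RtoC 0.
Proof.
  unfold coef. revert n k; induction l as [|a l IH]; intros [|n] [|k]; simpl; try reflexivity.
  - now destruct (_ <? _)%nat.
  - rewrite IH. reflexivity.
Qed.

(** Runge is applied with the disc of radius 1/lam: smallness of P G there becomes, by Cauchy,
    smallness of its coefficients relative to lam^k. In particular the terms up to degree N are
    negligible and can be cut off. *)
Lemma high_order_arc_approximation (z0 : C) (delta lam R0 eps : R) (N : nat) (G : list C) :
  Cmod z0 = 1 -> 0 < delta <= 1 -> 1 < lam -> / lam < R0 -> R0 <= 1 -> 0 < eps ->
  exists h, (forall k, (k <= N)%nat -> coef h k = RtoC 0) /\
    (forall k, Cmod (coef h k) <= lam ^ k) /\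
    (forall zeta, arc z0 delta zeta ->
      Cmod (eval h (RtoC R0 * zeta) - eval G (RtoC R0 * zeta))%C <= eps).
Proof.
  intros Hz0 Hdel Hlam HRl HR He.
  set (M := nrm G 1 + 1). assert (HM : 1 <= M) by (pose proof (nrm_ge0 G 1 ltac:(lra)); unfold M; lra).
  set (La := rsum (fun k => lam ^ k) (S N)).
  assert (HLa : 0 <= La) by (apply rsum_pos; intros; apply pow_le; lra).
  set (e1 := Rmin 1 eps). assert (He1 : 0 < e1) by (apply Rmin_pos; lra).
  assert (He2 : e1 <= 1) by apply Rmin_l. assert (He3 : e1 <= eps) by apply Rmin_r.
  (* The error is eta M from P and at most eta M La from the terms cut off, e1 in all. Since e1 <= 1
     also eta M <= 1, which yields the coefficient bound lam^k. *)
  set (eta := e1 / (M * (1 + La))).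
  assert (Heta : 0 < eta) by (apply Rdiv_lt_0_compat; nra).
  assert (Heta1 : eta * M * (1 + La) = e1) by (unfold eta; field; nra).
  assert (Hil : 0 < / lam) by (apply Rinv_0_lt_compat; lra).
  assert (Hil1 : / lam < 1) by (rewrite <- Rinv_1; apply Rinv_lt_contravar; lra).
  destruct (runge_disc_arc z0 delta (/ lam) R0 eta Hz0 Hdel ltac:(lra) HR Heta)
    as [P [[lP EP] [HP1 HP2]]].
  assert (HG : forall z, Cmod z <= 1 -> Cmod (eval G z) <= M).
  { intros z Hz. pose proof (Cmod_eval_le_nrm G z 1 Hz). unfold M; lra. }
  set (h0 := pmul lP G).
  assert (Hc : forall k, Cmod (coef h0 k) <= eta * M * lam ^ k).
  { intros k. pose proof (cauchy_estimate h0 (/ lam) (eta * M) Hil) as HC.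
    assert (H : Cmod (coef h0 k) * (/ lam) ^ k <= eta * M).
    { apply HC. intros t. unfold h0. rewrite eval_pmul, <- EP, Cmod_mult.
      assert (Hz : Cmod (RtoC (/ lam) * cis t) = / lam)
        by (rewrite Cmod_mult, Cmod_cis, Cmod_R, Rabs_pos_eq; lra).
      apply Rmult_le_compat; try apply Cmod_ge_0; [apply HP1|apply HG]; lra. }
    rewrite pow_inv in H.
    assert (Hlk : 0 < lam ^ k) by (apply pow_lt; lra).
    apply Rmult_le_reg_r with (/ lam ^ k); [now apply Rinv_0_lt_compat|].
    rewrite (Rmult_assoc (eta * M)), Rinv_r by lra. lra. }
  assert (HetaM : 0 < eta * M) by nra.
  exists (padd h0 (pscal (- RtoC 1)%C (firstn (S N) h0))); split; [|split].
  - intros k Hk. rewrite coef_padd, coef_pscal, coef_firstn.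
    destruct (Nat.ltb_spec k (S N)); [ring|lia].
  - intros k. rewrite coef_padd, coef_pscal, coef_firstn.
    assert (0 < lam ^ k) by (apply pow_lt; lra).
    destruct (k <? S N)%nat.
    + replace (coef h0 k + - RtoC 1 * coef h0 k)%C with (RtoC 0) by ring. rewrite Cmod_0; lra.
    + replace (coef h0 k + - RtoC 1 * RtoC 0)%C with (coef h0 k) by ring.
      eapply Rle_trans; [apply Hc|]. nra.
  - intros zeta Hzeta. assert (Hz : Cmod (RtoC R0 * zeta) <= 1).
    { destruct Hzeta as [H _]. rewrite Cmod_mult, H, Cmod_R, Rabs_pos_eq; lra. }
    specialize (HP2 zeta Hzeta). set (z := (RtoC R0 * zeta)%C) in *.
    rewrite eval_padd, eval_pscal. unfold h0 at 1. rewrite eval_pmul, <- EP.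
    assert (Hlow : Cmod (eval (firstn (S N) h0) z) <= eta * M * La).
    { rewrite (eval_coef _ (S N)) by apply firstn_le_length.
      eapply Rle_trans; [apply Cmod_csum|]. unfold La. rewrite <- rsum_scal. apply rsum_le.
      intros k Hk. rewrite coef_firstn. destruct (Nat.ltb_spec k (S N)); [|lia].
      rewrite Cmod_mult, Cmod_pow.
      assert (0 <= Cmod z ^ k <= 1).
      { split; [apply pow_le, Cmod_ge_0|]. rewrite <- (pow1 k).
        apply pow_incr; split; [apply Cmod_ge_0|exact Hz]. }
      pose proof (Hc k). pose proof (Cmod_ge_0 (coef h0 k)). nra. }
    replace (P z * eval G z + - RtoC 1 * eval (firstn (S N) h0) z - eval G z)%C
      with ((P z - RtoC 1) * eval G z + - eval (firstn (S N) h0) z)%C by ring.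
    eapply Rle_trans; [apply Cmod_triangle|]. rewrite Cmod_opp, Cmod_mult.
    assert (Cmod (P z - RtoC 1) * Cmod (eval G z) <= eta * M).
    { apply Rmult_le_compat; try apply Cmod_ge_0; [exact HP2|now apply HG]. }
    nra.
Qed.

(** * The inductive step *)

Definition subexponential (gamma : nat -> R) : Prop :=
  forall lam, 1 < lam -> exists N, forall k, (N <= k)%nat -> gamma k <= lam ^ k.

(** The invariant of the construction. The eventual upper bound makes the tail of a stage negligible
    on every smaller disc, so that the next stage may replace it. *)
Definition dominating (gamma : nat -> R) (a : nat -> C) : Prop :=
  (forall k, gamma k <= Cmod (a k)) /\
  exists N, forall k, (N <= k)%nat -> Cmod (a k) <= gamma k.

Lemma radii_near_one (r : nat -> R) (rho : R) (n0 : nat) :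
  admissible_radii r -> rho < 1 -> exists n, (n0 < n)%nat /\ rho < r n.
Proof.
  intros [_ [_ Hl]] Hrho. apply is_lim_seq_spec in Hl.
  destruct (Hl (mkposreal (1 - rho) ltac:(lra))) as [N HN]. simpl in HN.
  exists (S (N + n0)). split; [lia|].
  specialize (HN (S (N + n0)) ltac:(lia)). apply Rabs_def2 in HN. lra.
Qed.

Lemma geometric_tail_small (c x eps : R) : 0 <= c -> 0 <= x < 1 -> 0 < eps ->
  exists N, forall n, (N <= n)%nat -> c * x ^ n / (1 - x) <= eps.
Proof.
  intros Hc Hx He.
  destruct (pow_eventually_small x (eps * (1 - x) / (c + 1)) Hx) as [N HN].
  { apply Rdiv_lt_0_compat; nra. }
  exists N; intros n Hn. specialize (HN n Hn). apply Rle_div_l; [lra|].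
  apply Rle_div_r in HN; [|lra]. assert (0 <= x ^ n) by (apply pow_le; lra). nra.
Qed.

Lemma pow_ge_1 x n : 1 <= x -> 1 <= x ^ n.
Proof. intros H. rewrite <- (pow1 n). apply pow_incr; lra. Qed.

(** The exponent floor(j/m) + 1 lies just above j/m. The lower half of m floor(j/m) <= j < m
    (floor(j/m) + 1) bounds the power of B, at the price of one factor B; the upper half bounds the
    power of q. *)
Lemma pow_div_bounds (mu lam B q : R) (m j : nat) :
  1 < lam <= mu -> 1 <= B -> 0 < q -> (0 < m)%nat -> B <= mu ^ m -> lam ^ (2 * m) * q <= 1 ->
  B ^ (j / m + 1) <= B * mu ^ j /\ lam ^ j * q ^ (j / m + 1) <= (/ lam) ^ j.
Proof.
  intros Hl HB Hq Hm HBm Hlm.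
  assert (E1 : (m * (j / m) <= j)%nat) by (apply Nat.Div0.mul_div_le).
  assert (E2 : (j < m * (j / m + 1))%nat).
  { rewrite Nat.add_1_r. apply Nat.mul_succ_div_gt; lia. }
  split.
  - rewrite Nat.add_1_r. simpl. apply Rmult_le_compat_l; [lra|].
    apply Rle_trans with (mu ^ (m * (j / m))).
    + rewrite pow_mult. apply pow_incr; lra.
    + apply Rle_pow; [lra|exact E1].
  - assert (Hlj : 0 < lam ^ j) by (apply pow_lt; lra).
    rewrite pow_inv. apply Rmult_le_reg_l with (lam ^ j); [exact Hlj|].
    rewrite Rinv_r by lra. rewrite <- Rmult_assoc, <- pow_add.
    assert (Hqn : 0 <= q ^ (j / m + 1)) by (apply pow_le; lra).
    apply Rle_trans with ((lam ^ (2 * m) * q) ^ (j / m + 1)).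
    + rewrite Rpow_mult_distr. apply Rmult_le_compat_r; [exact Hqn|].
      rewrite <- pow_mult. apply Rle_pow; [lra|]. lia.
    + rewrite <- (pow1 (j / m + 1)). apply pow_incr. split; [|exact Hlm].
      apply Rmult_le_pos; [apply pow_le; lra|lra].
Qed.

Lemma approximation_step (gamma : nat -> R) (r : nat -> R) (a : nat -> C) (z0 : C)
  (delta s eps : R) (T : list C) (n0 N0 : nat) :
  (forall k, 0 < gamma k) -> subexponential gamma -> admissible_radii r ->
  dominating gamma a -> Cmod z0 = 1 -> 0 < delta <= 1 -> 0 <= s < 1 -> 0 < eps ->
  exists (a' : nat -> C) (n N : nat), dominating gamma a' /\ (n0 < n)%nat /\ (N0 < N)%nat /\
    (forall k, (k <= N)%nat -> a' k = a k) /\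
    (forall m, rsum (fun k => Cmod (a' k - a k)%C * s ^ k) m <= eps) /\
    exists M0, forall M, (M0 <= M)%nat -> forall zeta, arc z0 delta zeta ->
      Cmod (csum (fun k => a' k * (RtoC (r n) * zeta) ^ k)%C M - eval T zeta)%C <= eps.
Proof.
  intros Hg Hsub Hr [Ha1 [Na Ha2]] Hz0 Hdel Hs He.
  (* On the arc |zeta - z0| >= delta; passing to radius R0 loses 1 - R0, hence d = delta/2. None of
     these constants depends on R0. *)
  set (d := delta / 2). set (c := d * d / 4). set (q := 1 - c / 8). set (B := 1 + c / (1 - s)).
  assert (Hd : 0 < d <= 1) by (unfold d; lra).
  assert (Hc : 0 < c <= 1 / 4) by (unfold c; split; nra).
  assert (Hq : 0 < q < 1) by (unfold q; lra).
  assert (HB : 1 <= B).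
  { unfold B. assert (0 <= c / (1 - s)) by (apply Rdiv_le_0_compat; lra). lra. }
  destruct (exists_growth_rates s B q Hs Hq) as [mu [lam [m [Hlm [Hmus [Hm [HBm Hlq]]]]]]].
  set (x := lam * mu * s). set (y := / lam).
  assert (Hy : 0 < y < 1).
  { unfold y; split; [apply Rinv_0_lt_compat; lra|].
    rewrite <- Rinv_1; apply Rinv_lt_contravar; lra. }
  assert (Hx : 0 <= x < 1).
  { unfold x. assert (lam * mu * s <= mu * mu * s).
    { apply Rmult_le_compat_r; [lra|]. apply Rmult_le_compat_r; lra. }
    split; [|lra]. apply Rmult_le_pos; [|lra]. nra. }
  destruct (Hsub lam ltac:(lra)) as [N1 HN1].
  (* The budget on |z| <= s: 2 B for p, and 3 for h, the new tail and the discarded old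
     coefficients. *)
  destruct (geometric_tail_small (2 * B + 3) x eps ltac:(lra) Hx He) as [N2 HN2].
  destruct (geometric_tail_small 2 y (eps / 4) ltac:(lra) ltac:(lra) ltac:(lra)) as [N3 HN3].
  set (N := S (Na + N0 + N1 + N2 + N3)).
  (* R0 must exceed 1/lam for Runge, and 1 - d^2/8 so that 1 - R0^2 <= d^2/4 as the contraction
     requires. *)
  destruct (radii_near_one r (Rmax y (1 - d * d / 8)) n0 Hr) as [n [Hn0 Hn]].
  { apply Rmax_lub_lt; nra. }
  destruct Hr as [Hr01 _]. specialize (Hr01 n). set (R0 := r n) in *.
  assert (HRy : y < R0) by (eapply Rle_lt_trans; [apply Rmax_l|exact Hn]).
  assert (HRd : 1 - d * d / 8 < R0) by (eapply Rle_lt_trans; [apply Rmax_r|exact Hn]).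
  assert (HR2 : 1 - R0 * R0 <= d * d / 4) by nra.
  (* Since lam R0 > 1, the rate lam is useless at radius R0; the tail of gamma needs this second
     rate, with lam2 R0 < 1. *)
  set (lam2 := 2 / (1 + R0)).
  assert (Hlam2 : 1 < lam2) by (unfold lam2; apply Rlt_div_r; lra).
  assert (Hx2 : 0 <= lam2 * R0 < 1).
  { split; [nra|]. unfold lam2. replace (2 / (1 + R0) * R0) with (2 * R0 / (1 + R0)) by (field; lra).
    apply Rlt_div_l; lra. }
  (* The defect to be supplied by h: at z = R0 zeta it is T(zeta) minus the retained partial sum. *)
  assert (HG : polynomial (fun z => eval T (/ RtoC R0 * z) - csum (fun k => a k * z ^ k) (S N))%C).
  { apply polynomial_minus; [apply polynomial_comp_scal|apply polynomial_csum]. }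
  destruct HG as [G HG].
  destruct (high_order_arc_approximation z0 delta lam R0 (eps / 4) N G Hz0 Hdel
    ltac:(lra) HRy ltac:(lra) ltac:(lra)) as [h [Hh0 [Hhl HhG]]].
  destruct (arc_contraction_polynomial d R0 c Hd eq_refl ltac:(lra) HR2) as [b [Hb1 [Hb2 [Hb3 Hb4]]]].
  set (X := fun w => Cmod w = R0 /\ d <= Cmod (RtoC 1 - w)%C).
  set (g := fun k => gamma k + Cmod (coef h k)).
  assert (Hg0 : forall k, 0 <= g k).
  { intros k. pose proof (Hg k). pose proof (Cmod_ge_0 (coef h k)). unfold g; lra. }
  assert (Hgl : forall k, (N < k)%nat -> g k <= 2 * lam ^ k).
  { intros k Hk. specialize (HN1 k ltac:(lia)). specialize (Hhl k). unfold g; lra. }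
  destruct (Hsub lam2 Hlam2) as [N4 HN4].
  destruct (geometric_tail_small 1 (lam2 * R0) (eps / 4) ltac:(lra) Hx2 ltac:(lra)) as [N5 HN5].
  set (D := (N + length h + N4 + N5)%nat).
  destruct (large_coef_polynomial b N g (fun j => j / m + 1)%nat X s B q (2 * B) 2 x y
    Hb1 Hb2 ltac:(lra) (Hb3 s Hs)) with (D := D) as [p [Hp1 [Hp2 [Hp3 [Hp4 Hp5]]]]].
  { intros w [Hw1 Hw2]. split; [lra|now apply Hb4]. }
  { exact Hg0. }
  { intros j Hj. destruct (pow_div_bounds mu lam B q m j Hlm HB ltac:(lra) Hm HBm Hlq) as [E _].
    specialize (Hgl j Hj). specialize (Hg0 j). unfold x. rewrite !Rpow_mult_distr.
    assert (0 <= s ^ j) by (apply pow_le; lra).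
    assert (0 <= B ^ (j / m + 1)) by (apply pow_le; lra).
    replace (2 * B * (lam ^ j * mu ^ j * s ^ j)) with (2 * lam ^ j * s ^ j * (B * mu ^ j)) by ring.
    apply Rmult_le_compat; [nra|assumption| |exact E]. apply Rmult_le_compat_r; assumption. }
  { intros j Hj. destruct (pow_div_bounds mu lam B q m j Hlm HB ltac:(lra) Hm HBm Hlq) as [_ E].
    specialize (Hgl j Hj). unfold y.
    assert (0 <= q ^ (j / m + 1)) by (apply pow_le; lra). nra. }
  assert (TAIL : forall C0 u, 0 <= C0 -> 0 <= u < 1 ->
    rsum (fun j => if (j <=? N)%nat then 0 else C0 * u ^ j) (S D) <= C0 * u ^ (S N) / (1 - u)).
  { intros C0 u HC0 Hu. apply rsum_tail_geometric; [exact HC0|exact Hu| |]; intros k Hk;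
      destruct (Nat.leb_spec k N); try lia; lra. }
  set (iz := (/ z0)%C).
  assert (Hz0n : z0 <> RtoC 0) by (apply Cmod_eq_nz; lra).
  assert (Hiz : Cmod iz = 1) by (unfold iz; rewrite Cmod_inv, Hz0 by exact Hz0n; field).
  set (tl := fun k => if (k <=? D)%nat then 0 else gamma k).
  assert (Htl0 : forall k, 0 <= tl k).
  { intros k. unfold tl. destruct (k <=? D)%nat; [lra|left; apply Hg]. }
  (* The factor z0^(-k) turns powers of z into powers of w = z/z0, in which p and the tail have
     nonnegative coefficients; hence their moduli add in [Hpt]. *)
  set (a' := fun k => if (k <=? N)%nat then a k
                      else (coef h k + iz ^ k * (coef p k + RtoC (tl k)))%C).
  assert (Hpt : forall k, Cmod (iz ^ k * (coef p k + RtoC (tl k))) = Re (coef p k) + tl k).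
  { intros k. rewrite Cmod_mult, Cmod_pow, Hiz, pow1, Rmult_1_l, nonneg_Cmod.
    - reflexivity.
    - apply nonneg_plus; [apply Hp1|]. split; [reflexivity|apply Htl0]. }
  assert (Hpc : forall k, Cmod (coef p k) = Re (coef p k)) by (intros k; apply nonneg_Cmod, Hp1).
  exists a', n, N. split; [|split; [|split; [|split; [|split]]]].
  - split.
    + intros k. unfold a'. destruct (Nat.leb_spec k N) as [Hk|Hk]; [apply Ha1|].
      destruct (Nat.le_gt_cases k D) as [HkD|HkD].
      * rewrite Cplus_comm. eapply Rle_trans; [|apply Cmod_add_ge]. rewrite Hpt.
        specialize (Hp3 k ltac:(lia)). specialize (Htl0 k). unfold g in Hp3. lra.
      * rewrite coef_overflow by (unfold D in HkD; lia). rewrite Cplus_0_l, Hpt.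
        unfold tl. destruct (Nat.leb_spec k D); [lia|]. destruct (Hp1 k). lra.
    + exists (S (D + length p)). intros k Hk. unfold a'.
      destruct (Nat.leb_spec k N) as [HkN|HkN]; [unfold D in *; lia|].
      rewrite coef_overflow by (unfold D in Hk; lia). rewrite Cplus_0_l, Hpt.
      rewrite (coef_overflow p) by lia. unfold tl. destruct (Nat.leb_spec k D); [lia|]. simpl; lra.
  - exact Hn0.
  - unfold N; lia.
  - intros k Hk. unfold a'. destruct (Nat.leb_spec k N); [reflexivity|lia].
  - intros M.
    (* Beyond N the change consists of p, h, the new tail and the old coefficients. The last three
       are at most lam^k each, and lam s <= x; p is measured by its norm. *)
    apply Rle_trans with (rsum (fun k => Cmod (coef p k) * s ^ k +
      (if (k <=? N)%nat then 0 else 3 * x ^ k)) M).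
    { apply rsum_le. intros k _. assert (Hsk : 0 <= s ^ k) by (apply pow_le; lra). unfold a'.
      destruct (Nat.leb_spec k N) as [Hk|Hk].
      - replace (a k - a k)%C with (RtoC 0) by ring. rewrite Cmod_0.
        pose proof (Cmod_ge_0 (coef p k)). nra.
      - assert (H1 : Cmod (coef h k + iz ^ k * (coef p k + RtoC (tl k)) - a k)
                     <= lam ^ k + (Cmod (coef p k) + lam ^ k) + lam ^ k).
        { unfold Cminus. eapply Rle_trans; [apply Cmod_triangle|]. rewrite Cmod_opp.
          apply Rplus_le_compat.
          - eapply Rle_trans; [apply Cmod_triangle|]. rewrite Hpt, Hpc. specialize (Hhl k).
            assert (tl k <= lam ^ k); [|lra]. unfold tl. specialize (HN1 k ltac:(lia)).
            destruct (k <=? D)%nat; [apply pow_le; lra|exact HN1].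
          - eapply Rle_trans; [apply Ha2; unfold N in Hk; lia|]. apply HN1; lia. }
        assert (H2 : lam ^ k * s ^ k <= x ^ k).
        { rewrite <- Rpow_mult_distr. apply pow_incr. split; [nra|]. unfold x.
          assert (lam * s * 1 <= lam * s * mu) by (apply Rmult_le_compat_l; nra). lra. }
        pose proof (Cmod_ge_0 (coef h k + iz ^ k * (coef p k + RtoC (tl k)) - a k)). nra. }
    rewrite rsum_plus.
    apply Rle_trans with ((2 * B) * x ^ S N / (1 - x) + 3 * x ^ S N / (1 - x)).
    + apply Rplus_le_compat.
      * eapply Rle_trans; [apply coef_sum_le_nrm; lra|]. eapply Rle_trans; [exact Hp4|].
        apply TAIL; [lra|exact Hx].
      * apply rsum_tail_geometric; [lra|exact Hx| |]; intros k Hk;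
          destruct (Nat.leb_spec k N); try lia; lra.
    + specialize (HN2 (S N) ltac:(unfold N; lia)). eapply Rle_trans; [|exact HN2].
      right. field. lra.
  - exists (S (D + length p)). intros M HM zeta Hzeta. pose proof (HhG zeta Hzeta) as Hh.
    change (r n) with R0.
    pose proof Hzeta as [Hze1 Hze2]. set (z := (RtoC R0 * zeta)%C) in *.
    assert (HR0n : RtoC R0 <> RtoC 0) by (intros E; apply RtoC_inj in E; lra).
    rewrite <- HG in Hh. replace (/ RtoC R0 * z)%C with zeta in Hh by (unfold z; field; exact HR0n).
    set (w := (iz * z)%C).
    assert (Hzm : Cmod z = R0) by (unfold z; rewrite Cmod_mult, Cmod_R, Hze1, Rabs_pos_eq; lra).
    assert (Hw : X w).
    { split; [unfold w; rewrite Cmod_mult, Hiz, Hzm; ring|].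
      replace (RtoC 1 - w)%C with (iz * (z0 - z))%C by (unfold w, iz; field; exact Hz0n).
      rewrite Cmod_mult, Hiz, Rmult_1_l.
      replace (z0 - z)%C with (- (zeta - z0) + RtoC (1 - R0) * zeta)%C
        by (unfold z; rewrite RtoC_minus; ring).
      eapply Rle_trans; [|apply Cmod_add_ge].
      rewrite Cmod_opp, Cmod_mult, Cmod_R, Hze1, Rabs_pos_eq by lra. unfold d in *. nra. }
    rewrite (csum_ext _ (fun k => (if (k <=? N)%nat then a k * z ^ k else 0) +
      (coef h k * z ^ k + (coef p k * w ^ k + RtoC (tl k) * w ^ k)))%C).
    2:{ intros k _. unfold a', w. rewrite (Cpow_mult_dist iz z).
        destruct (Nat.leb_spec k N) as [Hk|Hk]; [|ring].
        rewrite Hh0, Hp2 by exact Hk. unfold tl.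
        destruct (Nat.leb_spec k D); [ring|unfold D in *; lia]. }
    rewrite !csum_plus.
    rewrite <- (eval_coef h M z) by (unfold D in HM; lia).
    rewrite <- (eval_coef p M w) by lia.
    rewrite (csum_stable _ (S N) M);
      [|unfold D in HM; lia|intros k Hk; destruct (Nat.leb_spec k N); [lia|reflexivity]].
    rewrite (csum_ext _ (fun k => a k * z ^ k)%C (S N)).
    2:{ intros k Hk. destruct (Nat.leb_spec k N); [reflexivity|lia]. }
    set (S1 := csum _ (S N)) in *. set (S2 := csum _ M).
    assert (HS2 : Cmod S2 <= eps / 4).
    { unfold S2. eapply Rle_trans; [apply Cmod_csum|].
      eapply Rle_trans; [apply rsum_tail_geometric with (c := 1) (x := lam2 * R0) (N := S D)|].
      - lra.
      - exact Hx2.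
      - intros k Hk. unfold tl. destruct (Nat.leb_spec k D); [|lia].
        rewrite Cmult_0_l, Cmod_0. reflexivity.
      - intros k Hk. unfold tl. destruct (Nat.leb_spec k D); [lia|].
        rewrite Cmod_mult, Cmod_pow, Cmod_R, Rabs_pos_eq by (left; apply Hg).
        destruct Hw as [-> _]. rewrite Rmult_1_l, Rpow_mult_distr.
        apply Rmult_le_compat_r; [apply pow_le; lra|]. apply HN4. unfold D in Hk; lia.
      - apply HN5. unfold D; lia. }
    assert (HS3 : Cmod (eval p w) <= eps / 4).
    { eapply Rle_trans; [now apply Hp5|]. eapply Rle_trans; [apply TAIL; lra|].
      apply HN3. unfold N; lia. }
    (* Three errors of at most eps/4 remain: from h, p and the tail. *)
    replace (S1 + (eval h z + (eval p w + S2)) - eval T zeta)%C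
      with ((eval h z - (eval T zeta - S1)) + (eval p w + S2))%C by ring.
    eapply Rle_trans; [apply Cmod_triangle|].
    pose proof (Cmod_triangle (eval p w) S2). lra.
Qed.

(** * Polynomial approximation on compact proper subsets of the circle *)

Definition approximable (X : C -> Prop) (F : C -> C) : Prop :=
  forall eps, 0 < eps ->
    exists P, polynomial P /\ forall z, X z -> Cmod (P z - F z)%C <= eps.

Lemma approximable_polynomial X F : polynomial F -> approximable X F.
Proof.
  intros HF eps He. exists F; split; [exact HF|]. intros z _.
  replace (F z - F z)%C with (RtoC 0) by ring. rewrite Cmod_0; lra.
Qed.

Lemma approximable_plus X F G :
  approximable X F -> approximable X G -> approximable X (fun z => F z + G z)%C.
Proof.
  intros HF HG eps He. destruct (HF (eps / 2) ltac:(lra)) as [P [HP EP]].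
  destruct (HG (eps / 2) ltac:(lra)) as [Q [HQ EQ]].
  exists (fun z => P z + Q z)%C; split; [now apply polynomial_plus|]. intros z Hz.
  replace (P z + Q z - (F z + G z))%C with ((P z - F z) + (Q z - G z))%C by ring.
  eapply Rle_trans; [apply Cmod_triangle|]. specialize (EP z Hz); specialize (EQ z Hz). lra.
Qed.

Lemma approximable_mult X F G M :
  (forall z, X z -> Cmod (F z) <= M) -> (forall z, X z -> Cmod (G z) <= M) ->
  approximable X F -> approximable X G -> approximable X (fun z => F z * G z)%C.
Proof.
  intros BF BG HF HG eps He.
  set (M' := Rmax M 0). assert (HM : M <= M') by apply Rmax_l. assert (HM0 : 0 <= M') by apply Rmax_r.
  set (e := Rmin 1 (eps / (2 * M' + 1))).
  assert (He0 : 0 < e) by (apply Rmin_pos; [lra|apply Rdiv_lt_0_compat; lra]).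
  assert (He1 : e <= 1) by apply Rmin_l.
  assert (He2 : e * (2 * M' + 1) <= eps) by (apply Rle_div_r; [lra|apply Rmin_r]).
  destruct (HF e He0) as [P [HP EP]]. destruct (HG e He0) as [Q [HQ EQ]].
  exists (fun z => P z * Q z)%C; split; [now apply polynomial_mult|]. intros z Hz.
  specialize (EP z Hz); specialize (EQ z Hz); specialize (BF z Hz); specialize (BG z Hz).
  replace (P z * Q z - F z * G z)%C
    with ((P z - F z) * (Q z - G z) + ((P z - F z) * G z + F z * (Q z - G z)))%C by ring.
  eapply Rle_trans; [apply Cmod_triangle|].
  pose proof (Cmod_triangle ((P z - F z) * G z) (F z * (Q z - G z))) as H.
  rewrite !Cmod_mult in *.
  pose proof (Cmod_ge_0 (P z - F z)). pose proof (Cmod_ge_0 (Q z - G z)).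
  pose proof (Cmod_ge_0 (F z)). pose proof (Cmod_ge_0 (G z)).
  assert (Cmod (P z - F z) * Cmod (Q z - G z) <= e * 1) by (apply Rmult_le_compat; lra).
  assert (Cmod (P z - F z) * Cmod (G z) <= e * M') by (apply Rmult_le_compat; lra).
  assert (Cmod (F z) * Cmod (Q z - G z) <= M' * e) by (apply Rmult_le_compat; lra).
  lra.
Qed.

(* Bernstein polynomials as expectations of [h] at the position of a random walk with
   [n] steps, each of length 1 with probability [t] and 0 otherwise. *)
Fixpoint bernstein (n : nat) (h : nat -> C) (t : C) : C :=
  match n with
  | O => h O
  | S n => (t * bernstein n (fun k => h (S k)) t + (RtoC 1 - t) * bernstein n h t)%C
  end.

Fixpoint bernsteinR (n : nat) (f : nat -> R) (t : R) : R :=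
  match n with
  | O => f O
  | S n => t * bernsteinR n (fun k => f (S k)) t + (1 - t) * bernsteinR n f t
  end.

Lemma bernsteinR_le n f g t : 0 <= t <= 1 -> (forall k, (k <= n)%nat -> f k <= g k) ->
  bernsteinR n f t <= bernsteinR n g t.
Proof.
  intros Ht; revert f g; induction n as [|n IH]; intros f g H; simpl; [now apply H|].
  assert (bernsteinR n (fun k => f (S k)) t <= bernsteinR n (fun k => g (S k)) t)
    by (apply IH; intros; apply H; lia).
  assert (bernsteinR n f t <= bernsteinR n g t) by (apply IH; intros; apply H; lia).
  nra.
Qed.

(** The second moment of the walk about c: squared bias plus the binomial variance n t (1 - t). The
    centre is left free because a step of the walk replaces c by c - 1. *)
Lemma bernsteinR_quadratic n A B c t :
  bernsteinR n (fun k => A + B * ((INR k - c) * (INR k - c))) t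
  = A + B * ((INR n * t - c) * (INR n * t - c) + INR n * t * (1 - t)).
Proof.
  revert c; induction n as [|n IH]; intros c; [simpl; ring|].
  assert (E : forall m f g u, (forall k, f k = g k) -> bernsteinR m f u = bernsteinR m g u).
  { clear. induction m as [|m IH]; intros f g u H; simpl; [apply H|].
    rewrite (IH f g) by exact H. rewrite (IH _ (fun k => g (S k))) by (intros; apply H). reflexivity. }
  change (bernsteinR (S n) ?f t) with
    (t * bernsteinR n (fun k => f (S k)) t + (1 - t) * bernsteinR n f t). cbv beta.
  rewrite (E n _ (fun k => A + B * ((INR k - (c - 1)) * (INR k - (c - 1))))).
  - rewrite !IH, S_INR. ring.
  - intros k. rewrite S_INR. ring.
Qed.

Lemma bernstein_deviation n h v t : 0 <= t <= 1 ->
  Cmod (bernstein n h (RtoC t) - v)%C <= bernsteinR n (fun k => Cmod (h k - v)%C) t.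
Proof.
  intros Ht; revert h; induction n as [|n IH]; intros h; simpl; [lra|].
  replace (RtoC t * bernstein n (fun k => h (S k)) (RtoC t) + (RtoC 1 - RtoC t) * bernstein n h (RtoC t) - v)%C
    with (RtoC t * (bernstein n (fun k => h (S k)) (RtoC t) - v)
          + RtoC (1 - t) * (bernstein n h (RtoC t) - v))%C by (rewrite RtoC_minus; ring).
  eapply Rle_trans; [apply Cmod_triangle|]. rewrite !Cmod_mult, !Cmod_R, !Rabs_pos_eq by lra.
  pose proof (IH h). pose proof (IH (fun k => h (S k))). cbv beta in *. nra.
Qed.

Lemma bernstein_bounded n h t M : 0 <= t <= 1 -> (forall k, Cmod (h k) <= M) ->
  Cmod (bernstein n h (RtoC t)) <= M.
Proof.
  intros Ht Hh. pose proof (bernstein_deviation n h (RtoC 0) t Ht) as H.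
  replace (bernstein n h (RtoC t) - RtoC 0)%C with (bernstein n h (RtoC t)) in H by ring.
  eapply Rle_trans; [exact H|].
  eapply Rle_trans; [apply (bernsteinR_le n _ (fun k => M + 0 * ((INR k - 0) * (INR k - 0)))); [exact Ht|]|].
  - intros k _. replace (h k - RtoC 0)%C with (h k) by ring. specialize (Hh k). lra.
  - rewrite bernsteinR_quadratic. lra.
Qed.

(** The parameter tau is not a polynomial in z, only a limit of such. The uniform bounds on t, 1 - t
    and the Bernstein values allow approximations to be multiplied along the recursion. *)
Lemma approximable_bernstein (X : C -> Prop) (tau : C -> R) n h M :
  (forall z, X z -> 0 <= tau z <= 1) -> (forall k, Cmod (h k) <= M) ->
  approximable X (fun z => RtoC (tau z)) ->
  approximable X (fun z => bernstein n h (RtoC (tau z))).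
Proof.
  intros Ht Hh Ha; revert h Hh; induction n as [|n IH]; intros h Hh; simpl.
  - apply approximable_polynomial, polynomial_const.
  - assert (HM1 : M <= Rmax M 1) by apply Rmax_l. assert (HM2 : 1 <= Rmax M 1) by apply Rmax_r.
    apply approximable_plus; apply approximable_mult with (Rmax M 1).
    + intros z Hz. specialize (Ht z Hz). rewrite Cmod_R, Rabs_pos_eq; lra.
    + intros z Hz. eapply Rle_trans; [apply bernstein_bounded with (M := M); auto|exact HM1].
    + exact Ha.
    + apply IH. intros; apply Hh.
    + intros z Hz. specialize (Ht z Hz). rewrite <- RtoC_minus, Cmod_R, Rabs_pos_eq; lra.
    + intros z Hz. eapply Rle_trans; [apply bernstein_bounded with (M := M); auto|exact HM1].
    + intros eps He. destruct (Ha eps He) as [P [HP EP]].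
      exists (fun z => RtoC 1 - P z)%C; split.
      * apply polynomial_minus; [apply polynomial_const|exact HP].
      * intros z Hz. replace (RtoC 1 - P z - (RtoC 1 - RtoC (tau z)))%C
          with (- (P z - RtoC (tau z)))%C by ring. rewrite Cmod_opp. now apply EP.
    + apply IH, Hh.
Qed.

(** * Consequences of compactness *)

Lemma open_of_Cmod (U : C -> Prop) :
  (forall z, U z -> exists e, 0 < e /\ forall w, Cmod (w - z)%C < e -> U w) -> open U.
Proof.
  intros H z Hz. destruct (H z Hz) as [e [He HU]].
  exists (mkposreal (e / 2) ltac:(lra)). intros w [H1 H2]. apply HU.
  eapply Rle_lt_trans; [apply Cmod_2Rmax|].
  assert (Hm : Rmax (Rabs (fst (w - z)%C)) (Rabs (snd (w - z)%C)) < e / 2).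
  { apply Rmax_lub_lt; [exact H1|exact H2]. }
  assert (0 <= Rmax (Rabs (fst (w - z)%C)) (Rabs (snd (w - z)%C)))
    by (eapply Rle_trans; [apply Rabs_pos|apply Rmax_l]).
  assert (sqrt 2 <= 2).
  { rewrite <- (sqrt_square 2) at 2 by lra. apply sqrt_le_1_alt; lra. }
  nra.
Qed.

Lemma compact_distance (K : C -> Prop) (z0 : C) : compactC K -> ~ K z0 ->
  exists delta, 0 < delta <= 1 /\ forall z, K z -> delta <= Cmod (z - z0)%C.
Proof.
  intros HK Hz0.
  destruct (HK nat (fun n z => / INR (S n) < Cmod (z - z0)%C)) as [l Hl].
  - intros n. apply open_of_Cmod. intros z Hz. exists (Cmod (z - z0) - / INR (S n)); split; [lra|].
    intros w Hw. pose proof (Cmod_triangle (z - w) (w - z0)) as H.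
    replace (z - w + (w - z0))%C with (z - z0)%C in H by ring. rewrite Cmod_minus_sym in Hw. lra.
  - intros z Hz. assert (Hp : 0 < Cmod (z - z0)%C).
    { apply Cmod_gt_0. intros E. apply Ceq_minus in E. now subst z. }
    destruct (archimed_cor1 _ Hp) as [n [Hn Hn0]]. exists (pred n).
    now replace (S (pred n)) with n by lia.
  - set (m := list_max l). exists (/ INR (S m)). split.
    + split; [apply Rinv_0_lt_compat, lt_0_INR; lia|].
      rewrite <- Rinv_1. apply Rinv_le_contravar; [lra|]. rewrite S_INR. pose proof (pos_INR m). lra.
    + intros z Hz. destruct (Hl z Hz) as [n [Hn Hd]].
      assert (n <= m)%nat.
      { pose proof (proj1 (list_max_le l m) (le_n _)) as H. rewrite Forall_forall in H. now apply H. }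
      eapply Rle_trans; [|left; exact Hd]. apply Rinv_le_contravar; [apply lt_0_INR; lia|].
      apply le_INR; lia.
Qed.

Lemma compact_uniform_continuity (K : C -> Prop) (phi : C -> C) (eps : R) :
  compactC K -> Defs.continuous_on K phi -> 0 < eps ->
  (exists e, 0 < e /\ forall z w, K z -> K w -> Cmod (w - z)%C < e -> Cmod (phi w - phi z)%C < eps) /\
  exists M, 0 <= M /\ forall z, K z -> Cmod (phi z) <= M.
Proof.
  intros HK Hphi He.
  (* The cover is indexed by pairs of a centre and a radius of continuity; a pair failing [P]
     contributes the empty set. Balls of half the radius give the usual Lebesgue number, and the
     finitely many centres the bound on phi. *)
  pose (P := fun i : C * R => K (fst i) /\ 0 < snd i /\
    forall w, K w -> Cmod (w - fst i)%C < snd i -> Cmod (phi w - phi (fst i))%C < eps / 2).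
  destruct (HK (C * R)%type (fun i w => P i /\ Cmod (w - fst i)%C < snd i / 2)) as [l Hl].
  - intros i. apply open_of_Cmod. intros z [Hi Hz]. exists (snd i / 2 - Cmod (z - fst i)%C).
    split; [lra|]. intros w Hw. split; [exact Hi|].
    pose proof (Cmod_triangle (w - z) (z - fst i)) as H.
    replace (w - z + (z - fst i))%C with (w - fst i)%C in H by ring. lra.
  - intros z Hz. destruct (Hphi z Hz (eps / 2) ltac:(lra)) as [d [Hd HP]].
    exists (z, d). repeat split; simpl; trivial.
    replace (z - z)%C with (RtoC 0) by ring. rewrite Cmod_0; lra.
  - split.
    + assert (Hmin : exists e, 0 < e /\ forall i, In i l -> P i -> e <= snd i / 2).
      { clear Hl. induction l as [|i l [e [He0 IH]]]; [exists 1; split; [lra|easy]|].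
        destruct (Rlt_dec 0 (snd i)) as [Hi|Hi].
        - exists (Rmin e (snd i / 2)); split; [apply Rmin_pos; lra|].
          intros j [<-|Hj] HPj; [apply Rmin_r|].
          eapply Rle_trans; [apply Rmin_l|now apply IH].
        - exists e; split; [exact He0|]. intros j [<-|Hj] HPj; [|now apply IH].
          destruct HPj as [_ [H _]]. lra. }
      destruct Hmin as [e [He0 Hmin]]. exists e; split; [exact He0|].
      intros z w Hz Hw Hzw. destruct (Hl z Hz) as [i [Hi [HP Hzi]]].
      specialize (Hmin i Hi HP). destruct HP as [_ [Hi0 HP]].
      pose proof (HP z Hz ltac:(lra)) as H1.
      pose proof (Cmod_triangle (w - z) (z - fst i)) as H.
      replace (w - z + (z - fst i))%C with (w - fst i)%C in H by ring.
      pose proof (HP w Hw ltac:(lra)) as H2.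
      pose proof (Cmod_triangle (phi w - phi (fst i)) (- (phi z - phi (fst i)))) as H3.
      replace (phi w - phi (fst i) + - (phi z - phi (fst i)))%C with (phi w - phi z)%C in H3 by ring.
      rewrite Cmod_opp in H3. lra.
    + assert (Hmax : exists M, 0 <= M /\ forall i, In i l -> Cmod (phi (fst i)) <= M).
      { clear Hl. induction l as [|i l [M [HM0 IH]]]; [exists 0; split; [lra|easy]|].
        exists (Rmax M (Cmod (phi (fst i)))); split; [eapply Rle_trans; [exact HM0|apply Rmax_l]|].
        intros j [<-|Hj]; [apply Rmax_r|]. eapply Rle_trans; [now apply IH|apply Rmax_l]. }
      destruct Hmax as [M [HM0 Hmax]]. exists (M + eps); split; [lra|].
      intros z Hz. destruct (Hl z Hz) as [i [Hi [[_ [Hi0 HP]] Hzi]]].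
      specialize (Hmax i Hi). pose proof (HP z Hz ltac:(lra)).
      pose proof (Cmod_sub_ge (phi z) (phi (fst i))). lra.
Qed.

(* The Cayley transform z0 / (z - z0) maps the circle minus z0 onto the line Re = -1/2. *)
Definition cayley_parameter (z0 : C) (Y : R) (z : C) : R :=
  (Y - Im (z0 / (z - z0))%C) / (2 * Y).

(** On the line Re = -1/2 the imaginary part of x is an affine function of x. So the real parameter
    is a rational function of z whose only pole is z0, and Runge's theorem applies to it. That x
    lies on the line follows from |1 + x| = |z| / |z - z0| = |x|. *)
Lemma cayley_parameter_eq (z0 z : C) (Y : R) : Cmod z0 = 1 -> Cmod z = 1 -> z <> z0 -> 0 < Y ->
  RtoC (cayley_parameter z0 Y z)
  = ((Ci * (z0 / (z - z0) + RtoC (1 / 2)) + RtoC Y) / RtoC (2 * Y))%C.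
Proof.
  intros H0 H1 Hne HY.
  assert (Hn : (z - z0)%C <> RtoC 0) by (intros E; now apply Hne, Ceq_minus).
  assert (HY' : RtoC (2 * Y) <> RtoC 0) by (intros E; apply RtoC_inj in E; lra).
  set (x := (z0 / (z - z0))%C).
  assert (Hx : Re x = - 1 / 2).
  { assert (E : Cmod (RtoC 1 + x) = Cmod x).
    { replace (RtoC 1 + x)%C with (z / (z - z0))%C by (unfold x; field; exact Hn).
      unfold x. now rewrite !Cmod_div, H0, H1 by exact Hn. }
    assert (E2 : Cmod (RtoC 1 + x) * Cmod (RtoC 1 + x) = Cmod x * Cmod x) by now rewrite E.
    rewrite !Cmod_sqr in E2. destruct x as [u v]; simpl in *. lra. }
  unfold cayley_parameter. fold x. rewrite RtoC_div by lra. f_equal.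
  destruct x as [u v]. simpl in Hx. subst u.
  unfold RtoC, Ci, Cplus, Cmult; simpl. f_equal; field.
Qed.

Lemma cayley_parameter_bounds (z0 z : C) (delta Y : R) : Cmod z0 = 1 -> 0 < delta ->
  delta <= Cmod (z - z0)%C -> Y = / delta -> 0 <= cayley_parameter z0 Y z <= 1.
Proof.
  intros H0 Hd Hz ->. assert (Hi : 0 < / delta) by now apply Rinv_0_lt_compat.
  assert (Hn : (z - z0)%C <> RtoC 0) by (apply Cmod_eq_nz; lra).
  assert (HI : Rabs (Im (z0 / (z - z0))%C) <= / delta).
  { eapply Rle_trans; [eapply Rle_trans; [apply Rmax_r|apply Rmax_Cmod]|].
    rewrite Cmod_div, H0 by exact Hn. unfold Rdiv. rewrite Rmult_1_l.
    apply Rinv_le_contravar; lra. }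
  apply Rabs_le_between in HI. unfold cayley_parameter. split.
  - apply Rdiv_le_0_compat; lra.
  - apply Rle_div_l; lra.
Qed.

(** The parameters differ by |z - w| / (2 Y |z - z0| |w - z0|) in modulus, and both distances are at
    most 2. This carries the modulus of continuity of phi over to the parameter. *)
Lemma cayley_parameter_inverse_lipschitz (z0 z w : C) (Y : R) :
  Cmod z0 = 1 -> Cmod z = 1 -> Cmod w = 1 -> z <> z0 -> w <> z0 -> 0 < Y ->
  Cmod (z - w)%C <= 8 * Y * Rabs (cayley_parameter z0 Y z - cayley_parameter z0 Y w).
Proof.
  intros H0 Hz Hw Hzn Hwn HY.
  assert (Hn : (z - z0)%C <> RtoC 0) by (intros E; now apply Hzn, Ceq_minus).
  assert (Hm : (w - z0)%C <> RtoC 0) by (intros E; now apply Hwn, Ceq_minus).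
  assert (HY' : RtoC (2 * Y) <> RtoC 0) by (intros E; apply RtoC_inj in E; lra).
  rewrite <- Cmod_R, RtoC_minus, !cayley_parameter_eq by trivial.
  set (D := Cmod _) at 2.
  assert (E : (z - w)%C = (((Ci * (z0 / (z - z0) + RtoC (1 / 2)) + RtoC Y) / RtoC (2 * Y)
     - (Ci * (z0 / (w - z0) + RtoC (1 / 2)) + RtoC Y) / RtoC (2 * Y))
     * (Ci * / z0 * RtoC (2 * Y) * (z - z0) * (w - z0)))%C).
  { assert (Hi : (Ci * Ci)%C = (- RtoC 1)%C).
    { unfold Ci, Cmult, Copp, RtoC; simpl; f_equal; ring. }
    assert (Hz0 : z0 <> RtoC 0) by (apply Cmod_eq_nz; lra).
    transitivity (Ci * Ci * (w - z))%C; [rewrite Hi; ring|]. field. repeat split; assumption. }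
  rewrite E at 1. rewrite Cmod_mult. fold D.
  rewrite !Cmod_mult, Cmod_Ci, Cmod_inv, H0, Cmod_R, Rinv_1, Rabs_pos_eq
    by (try lra; apply Cmod_eq_nz; lra).
  assert (H4 : forall u, Cmod u = 1 -> Cmod (u - z0)%C <= 2).
  { intros u Hu. unfold Cminus. eapply Rle_trans; [apply Cmod_triangle|]. rewrite Cmod_opp; lra. }
  pose proof (H4 z Hz). pose proof (H4 w Hw).
  pose proof (Cmod_ge_0 (z - z0)). pose proof (Cmod_ge_0 (w - z0)).
  assert (Cmod (z - z0) * Cmod (w - z0) <= 4) by nra.
  assert (0 <= D) by apply Cmod_ge_0. assert (0 <= D * Y) by nra. nra.
Qed.

Lemma approximable_cayley_parameter (K : C -> Prop) (z0 : C) (delta Y : R) :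
  Cmod z0 = 1 -> 0 < delta <= 1 -> 0 < Y ->
  (forall z, K z -> Cmod z = 1 /\ delta <= Cmod (z - z0)%C) ->
  approximable K (fun z => RtoC (cayley_parameter z0 Y z)).
Proof.
  intros H0 Hd HY HK eps He.
  assert (Hinv : approx_inv K (fun z => z - RtoC 1 * z0)%C).
  { apply approx_inv_ray with (delta / 2); [exact H0|lra|lra| |].
    - intros z Hz. destruct (HK z Hz). lra.
    - intros tau z Htau Hz. destruct (HK z Hz) as [K1 K2].
      pose proof (dist_to_ray z0 z 1 tau delta H0 K1 ltac:(lra) ltac:(lra) K2) as H.
      replace (RtoC 1 * z)%C with z in H by ring. lra. }
  (* Passing from relative to absolute error divides by 2 Y |z - z0| >= 2 Y delta. *)
  destruct (Hinv (eps * delta * (2 * Y))) as [Q [HQ EQ]].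
  { repeat apply Rmult_lt_0_compat; lra. }
  assert (HY' : RtoC (2 * Y) <> RtoC 0) by (intros E; apply RtoC_inj in E; lra).
  exists (fun z => Ci * z0 / RtoC (2 * Y) * Q z + (Ci * RtoC (1 / 2) + RtoC Y) / RtoC (2 * Y))%C. split.
  - apply polynomial_plus; [|apply polynomial_const].
    apply polynomial_mult; [apply polynomial_const|exact HQ].
  - intros z Hz. destruct (HK z Hz) as [K1 K2]. specialize (EQ z Hz).
    assert (Hn : (z - z0)%C <> RtoC 0) by (apply Cmod_eq_nz; lra).
    assert (Hne : z <> z0) by (intros E; apply Hn; now apply Ceq_minus in E).
    rewrite cayley_parameter_eq by trivial.
    match goal with |- Cmod ?y <= _ =>
      replace y with (- (Ci * z0 / RtoC (2 * Y) / (z - z0) * (RtoC 1 - (z - RtoC 1 * z0) * Q z)))%C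
        by (field; split; assumption) end.
    rewrite Cmod_opp, Cmod_mult, !Cmod_div, Cmod_mult, Cmod_Ci, H0, Cmod_R, Rabs_pos_eq
      by (try lra; assumption).
    set (v := Cmod (RtoC 1 - (z - RtoC 1 * z0) * Q z)) in *.
    replace (1 * 1 / (2 * Y) / Cmod (z - z0) * v) with (v / (2 * Y * Cmod (z - z0)))
      by (field; split; lra).
    apply Rle_div_l; [nra|]. eapply Rle_trans; [exact EQ|].
    assert (0 < eps * (2 * Y)) by nra.
    replace (eps * delta * (2 * Y)) with (eps * (2 * Y) * delta) by ring.
    replace (eps * (2 * Y * Cmod (z - z0))) with (eps * (2 * Y) * Cmod (z - z0)) by ring.
    apply Rmult_le_compat_l; lra.
Qed.

Lemma weierstrass_arc (K : C -> Prop) (phi : C -> C) (z0 : C) (eps : R) :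
  (forall z, K z -> circle z) -> compactC K -> circle z0 -> ~ K z0 -> Defs.continuous_on K phi ->
  0 < eps -> exists T, forall z, K z -> Cmod (eval T z - phi z)%C <= eps.
Proof.
  intros HKc HK H0 Hz0 Hphi He. red in H0.
  destruct (compact_distance K z0 HK Hz0) as [delta [Hd Hdist]].
  destruct (compact_uniform_continuity K phi (eps / 4) HK Hphi ltac:(lra))
    as [[e [He0 Hunif]] [M [HM HMphi]]].
  set (Y := / delta). assert (HY : 0 < Y) by (apply Rinv_0_lt_compat; lra).
  set (tau := cayley_parameter z0 Y).
  assert (HKne : forall z, K z -> z <> z0) by (intros z Hz ->; exact (Hz0 Hz)).
  assert (Htau : forall z, K z -> 0 <= tau z <= 1).
  { intros z Hz. apply (cayley_parameter_bounds z0 z delta); try easy; now apply Hdist. }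
  (* Two points within eta of the same node have parameters less than 2 eta apart, hence are closer
     than 8 Y (2 eta) = e on the circle. *)
  set (eta := e / (16 * Y)). assert (Heta : 0 < eta) by (apply Rdiv_lt_0_compat; lra).
  assert (Heta' : 16 * Y * eta = e) by (unfold eta; field; lra).
  (* At nodes at distance at least eta, the quadratic with coefficient c exceeds the trivial bound 2
     M. *)
  set (c := 2 * M / (eta * eta)).
  assert (Hc : 0 <= c) by (apply Rdiv_le_0_compat; nra).
  destruct (archimed_cor1 (eps / 4 / (c + 1)) ltac:(apply Rdiv_lt_0_compat; lra)) as [n [Hn Hn0]].
  assert (Hn1 : 0 < INR n) by (apply lt_0_INR; lia).
  (* K may leave holes, so a node takes the value of phi at some nearby point of K, and 0 if there
     is none. The default is harmless: such a node is at distance at least eta from every tau z. *)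
  pose (near := fun k w => K w /\ Rabs (tau w - INR k / INR n) < eta).
  assert (Hsel : forall k, exists v : C, Cmod v <= M /\
    ((exists w, near k w /\ v = phi w) \/ (forall w, ~ near k w))).
  { intros k. destruct (classic (exists w, near k w)) as [[w Hw]|Hno].
    - exists (phi w); split; [apply HMphi, Hw|]. left; now exists w.
    - exists (RtoC 0); split; [now rewrite Cmod_0|]. right; intros w Hw; apply Hno; now exists w. }
  set (h := fun k => proj1_sig (constructive_indefinite_description _ (Hsel k))).
  assert (Hh : forall k, Cmod (h k) <= M /\
    ((exists w, near k w /\ h k = phi w) \/ (forall w, ~ near k w))).
  { intros k. unfold h. now destruct constructive_indefinite_description as [v Hv]. }
  clearbody h.
  destruct (approximable_bernstein K tau n h M Htau (fun k => proj1 (Hh k))) with (eps := eps / 2)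
    as [P [[T HT] EP]].
  { apply (approximable_cayley_parameter K z0 delta Y H0 Hd HY).
    intros z Hz; split; [now apply HKc|now apply Hdist]. }
  { lra. }
  exists T. intros z Hz. specialize (EP z Hz). rewrite <- HT.
  specialize (Htau z Hz) as Ht.
  assert (HB : Cmod (bernstein n h (RtoC (tau z)) - phi z)%C <= eps / 2).
  { eapply Rle_trans; [now apply bernstein_deviation|].
    set (B := c / (INR n * INR n)).
    eapply Rle_trans; [apply (bernsteinR_le n _ (fun k => eps / 4 +
      B * ((INR k - INR n * tau z) * (INR k - INR n * tau z)))); [exact Ht|]|].
    - intros k Hk. destruct (Hh k) as [Hk1 Hk2].
      set (x := INR k / INR n - tau z).
      replace (B * ((INR k - INR n * tau z) * (INR k - INR n * tau z))) with (c * (x * x))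
        by (unfold B, x; field; lra).
      destruct (Rlt_le_dec (Rabs x) eta) as [Hx|Hx].
      + assert (Hnz : near k z).
        { split; [exact Hz|]. rewrite Rabs_minus_sym. exact Hx. }
        destruct Hk2 as [[w [[Hw1 Hw2] ->]]|Hno]; [|now apply Hno in Hnz].
        assert (Cmod (phi w - phi z) < eps / 4).
        { apply Hunif; trivial. eapply Rle_lt_trans.
          - apply (cayley_parameter_inverse_lipschitz z0 w z Y); auto; now apply HKc.
          - fold tau. replace (tau w - tau z) with ((tau w - INR k / INR n) + x) by (unfold x; ring).
            pose proof (Rabs_triang (tau w - INR k / INR n) x). nra. }
        assert (0 <= c * (x * x)) by (apply Rmult_le_pos; nra). lra.
      + assert (Hxx : eta * eta <= x * x).
        { replace (x * x) with (Rabs x * Rabs x) by (rewrite <- Rabs_mult; apply Rabs_pos_eq; nra). nra. }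
        assert (c * (eta * eta) <= c * (x * x)) by (apply Rmult_le_compat_l; lra).
        assert (c * (eta * eta) = 2 * M) by (unfold c; field; lra).
        pose proof (HMphi z Hz). unfold Cminus. eapply Rle_trans; [apply Cmod_triangle|].
        rewrite Cmod_opp. lra.
    - rewrite bernsteinR_quadratic.
      replace (eps / 4 + B * ((INR n * tau z - INR n * tau z) * (INR n * tau z - INR n * tau z)
        + INR n * tau z * (1 - tau z))) with (eps / 4 + c * / INR n * (tau z * (1 - tau z)))
        by (unfold B; field; lra).
      assert (Hi : 0 < / INR n) by now apply Rinv_0_lt_compat.
      assert (c * / INR n <= eps / 4).
      { apply Rlt_div_r in Hn; [|lra]. nra. }
      assert (0 <= c * / INR n) by nra. assert (0 <= tau z * (1 - tau z) <= 1) by nra. nra. }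
  replace (P z - phi z)%C with ((P z - bernstein n h (RtoC (tau z)))
    + (bernstein n h (RtoC (tau z)) - phi z))%C by ring.
  eapply Rle_trans; [apply Cmod_triangle|]. lra.
Qed.

(** * Enumeration of the approximation tasks *)

Definition dense_real (n : nat) : R :=
  let (a, b) := Cantor.of_nat n in let (c, d) := Cantor.of_nat b in
  (INR a - INR c) / INR (S d).

Definition dense_complex (n : nat) : C :=
  let (a, b) := Cantor.of_nat n in (dense_real a, dense_real b).

Lemma dense_real_spec (x eps : R) : 0 < eps -> exists n, Rabs (dense_real n - x) <= eps.
Proof.
  intros He. destruct (archimed_cor1 eps He) as [N [HN HN0]].
  set (d := pred N). assert (Ed : S d = N) by (unfold d; lia).
  assert (Hp : 0 < INR (S d)) by (apply lt_0_INR; lia).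
  set (m := up (x * INR (S d))).
  exists (Cantor.to_nat (Z.to_nat m, Cantor.to_nat (Z.to_nat (- m), d))).
  unfold dense_real. rewrite !Cantor.cancel_of_to.
  assert (E : INR (Z.to_nat m) - INR (Z.to_nat (- m)) = IZR m).
  { rewrite !INR_IZR_INZ, <- minus_IZR. f_equal. lia. }
  rewrite E. destruct (archimed (x * INR (S d))) as [H1 H2]. fold m in H1, H2.
  replace (IZR m / INR (S d) - x) with ((IZR m - x * INR (S d)) * / INR (S d)) by (field; lra).
  rewrite Ed in *. assert (0 < / INR N) by now apply Rinv_0_lt_compat.
  rewrite Rabs_pos_eq; nra.
Qed.

Lemma dense_complex_spec (z : C) (eps : R) : 0 < eps ->
  exists n, Cmod (dense_complex n - z)%C <= eps.
Proof.
  intros He. destruct z as [x y].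
  destruct (dense_real_spec x (eps / 2) ltac:(lra)) as [a Ha].
  destruct (dense_real_spec y (eps / 2) ltac:(lra)) as [b Hb].
  exists (Cantor.to_nat (a, b)). unfold dense_complex. rewrite Cantor.cancel_of_to.
  replace ((dense_real a, dense_real b) - (x, y))%C
    with (RtoC (dense_real a - x) + Ci * RtoC (dense_real b - y))%C.
  - eapply Rle_trans; [apply Cmod_triangle|]. rewrite Cmod_mult, Cmod_Ci, !Cmod_R. lra.
  - unfold Cminus, Cplus, Copp, Ci, Cmult, RtoC; simpl. f_equal; ring.
Qed.

Lemma dense_polynomial (T : list C) (eps : R) : 0 < eps ->
  exists l, forall z, Cmod z <= 1 -> Cmod (eval (map dense_complex l) z - eval T z)%C <= eps.
Proof.
  revert eps; induction T as [|a T IH]; intros eps He.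
  - exists nil. intros z _. simpl. replace (RtoC 0 - RtoC 0)%C with (RtoC 0) by ring.
    rewrite Cmod_0; lra.
  - destruct (IH (eps / 2) ltac:(lra)) as [l Hl].
    destruct (dense_complex_spec a (eps / 2) ltac:(lra)) as [n Hn].
    exists (n :: l). intros z Hz. simpl. specialize (Hl z Hz).
    replace (dense_complex n + z * eval (map dense_complex l) z - (a + z * eval T z))%C
      with ((dense_complex n - a) + z * (eval (map dense_complex l) z - eval T z))%C by ring.
    eapply Rle_trans; [apply Cmod_triangle|]. rewrite Cmod_mult.
    pose proof (Cmod_ge_0 (eval (map dense_complex l) z - eval T z)). pose proof (Cmod_ge_0 z). nra.
Qed.

(** The value 1 at v = 0 keeps every result on the circle, so every index codes a legitimate gap
    point. *)
Definition normalize (v : C) : C :=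
  if Req_EM_T (Cmod v) 0 then RtoC 1 else (v / RtoC (Cmod v))%C.

Lemma Cmod_normalize v : Cmod (normalize v) = 1.
Proof.
  unfold normalize. destruct Req_EM_T as [|H]; [apply Cmod_1|].
  pose proof (Cmod_ge_0 v).
  rewrite Cmod_div, Cmod_R, Rabs_pos_eq by (try lra; intros E; apply RtoC_inj in E; lra).
  field; exact H.
Qed.

Lemma normalize_near (z v : C) (e : R) : Cmod z = 1 -> e < 1 -> Cmod (v - z)%C <= e ->
  Cmod (normalize v - z)%C <= 2 * e.
Proof.
  intros Hz He Hv. unfold normalize. pose proof (Cmod_sub_ge z v) as H1.
  rewrite Cmod_minus_sym in H1. pose proof (Cmod_sub_ge v z) as H2.
  destruct Req_EM_T as [E|E]; [lra|].
  assert (Hn : RtoC (Cmod v) <> RtoC 0) by (intros E'; apply RtoC_inj in E'; lra).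
  assert (H3 : Cmod (v / RtoC (Cmod v) - v) <= e).
  { replace (v / RtoC (Cmod v) - v)%C with (v / RtoC (Cmod v) * RtoC (1 - Cmod v))%C
      by (rewrite RtoC_minus; field; exact Hn).
    rewrite Cmod_mult, Cmod_div, !Cmod_R by exact Hn. pose proof (Cmod_ge_0 v).
    rewrite (Rabs_pos_eq (Cmod v)) by lra. replace (Cmod v / Cmod v) with 1 by (field; lra).
    rewrite Rmult_1_l. apply Rabs_le. lra. }
  pose proof (Cmod_triangle (v / RtoC (Cmod v) - v) (v - z)) as H4.
  replace (v / RtoC (Cmod v) - v + (v - z))%C with (v / RtoC (Cmod v) - z)%C in H4 by ring. lra.
Qed.

(* The second Cantor component is ignored, so that every task recurs infinitely often. *)
Definition task (i : nat) : list nat := mathcomp.boot.choice.CodeSeq.decode (fst (Cantor.of_nat i)).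
Definition task_gap (i : nat) : C := normalize (dense_complex (nth 0 (task i) 0%nat)).
Definition task_width (i : nat) : R := / INR (S (nth 1 (task i) 0%nat)).
Definition task_target (i : nat) : list C := map dense_complex (skipn 2 (task i)).

Lemma task_width_bounds i : 0 < task_width i <= 1.
Proof.
  unfold task_width. split; [apply Rinv_0_lt_compat, lt_0_INR; lia|].
  rewrite <- Rinv_1. apply Rinv_le_contravar; [lra|].
  rewrite S_INR. pose proof (pos_INR (nth 1 (task i) 0%nat)). lra.
Qed.

(** Normalisation at most doubles the error delta/4 of the gap point, and the width 1/m is below
    delta/2; together they fit into delta. The spare component [i0] of the code pushes the index
    beyond [i0]. *)
Lemma task_dense (z0 : C) (delta : R) (T : list C) (eps : R) (i0 : nat) :
  Cmod z0 = 1 -> 0 < delta <= 1 -> 0 < eps ->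
  exists i, (i0 <= i)%nat /\
    (forall z, arc z0 delta z -> arc (task_gap i) (task_width i) z) /\
    forall z, Cmod z <= 1 -> Cmod (eval (task_target i) z - eval T z)%C <= eps.
Proof.
  intros Hz0 Hd He.
  destruct (dense_complex_spec z0 (delta / 4) ltac:(lra)) as [n Hn].
  destruct (archimed_cor1 (delta / 2) ltac:(lra)) as [m [Hm Hm0]].
  destruct (dense_polynomial T eps He) as [l Hl].
  set (L := (n :: pred m :: l)).
  exists (Cantor.to_nat (mathcomp.boot.choice.CodeSeq.code L, i0)).
  assert (EL : task (Cantor.to_nat (mathcomp.boot.choice.CodeSeq.code L, i0)) = L).
  { unfold task. rewrite Cantor.cancel_of_to. apply mathcomp.boot.choice.CodeSeq.codeK. }
  split; [pose proof (Cantor.to_nat_non_decreasing (mathcomp.boot.choice.CodeSeq.code L) i0); lia|].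
  unfold task_gap, task_width, task_target. rewrite EL. unfold L; simpl nth; simpl skipn.
  split; [|exact Hl].
  intros z [Hz1 Hz2]. split; [exact Hz1|]. replace (S (pred m)) with m by lia.
  pose proof (normalize_near z0 (dense_complex n) (delta / 4) Hz0 ltac:(lra) Hn) as H.
  pose proof (Cmod_triangle (z - normalize (dense_complex n)) (normalize (dense_complex n) - z0)) as H1.
  replace (z - normalize (dense_complex n) + (normalize (dense_complex n) - z0))%C
    with (z - z0)%C in H1 by ring. lra.
Qed.

(** * The universal function *)

Lemma subexponential_of_kroot (gamma : nat -> R) : (forall k, 0 < gamma k) ->
  Rbar_le (LimSup_seq (fun k => kroot (gamma k) k)) 1 -> subexponential gamma.
Proof.
  intros Hg HL lam Hlam.
  assert (HN : exists N, forall n, (N <= n)%nat -> kroot (gamma n) n < lam).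
  { unfold LimSup_seq in HL. destruct (ex_LimSup_seq _) as [l Hl]. simpl in HL.
    destruct l as [l| |]; simpl in HL; [|easy|].
    - destruct (Hl (mkposreal (lam - 1) ltac:(lra))) as [_ [N HN]]. exists N. intros n Hn.
      specialize (HN n Hn). simpl in HN. lra.
    - exact (Hl lam). }
  destruct HN as [N HN]. exists (S N). intros k Hk. specialize (HN k ltac:(lia)).
  unfold kroot in HN. pose proof (Hg k) as Hgk.
  destruct (Req_EM_T (gamma k) 0) as [E|_]; [lra|].
  assert (Hk0 : 0 < INR k) by (apply lt_0_INR; lia).
  assert (E : Rpower (gamma k) (/ INR k) ^ k = gamma k).
  { rewrite <- Rpower_pow by apply exp_pos. rewrite Rpower_mult, Rinv_l by lra.
    now apply Rpower_1. }
  rewrite <- E. apply pow_incr. split; [left; apply exp_pos|lra].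
Qed.

Lemma ex_series_geometric_bound (u : nat -> C) (c x : R) (N : nat) :
  0 <= x < 1 -> (forall k, (N <= k)%nat -> Cmod (u k) <= c * x ^ k) -> ex_series u.
Proof.
  intros Hx Hu. apply (ex_series_incr_n u N).
  apply (ex_series_le (K := C_AbsRing) (V := C_CompleteNormedModule)) with (fun k => (c * x ^ N) * x ^ k).
  - intros k. change (Cmod (u (N + k)%nat) <= c * x ^ N * x ^ k).
    rewrite Rmult_assoc, <- pow_add. apply Hu. lia.
  - apply (ex_series_scal_l (K := R_AbsRing) (V := R_NormedModule)).
    apply ex_series_geom. rewrite Rabs_pos_eq; lra.
Qed.

Lemma sum_n_csum (u : nat -> C) (n : nat) : sum_n u n = csum u (S n).
Proof.
  induction n as [|n IH].
  - rewrite sum_O. simpl. ring.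
  - rewrite sum_Sn, IH. reflexivity.
Qed.

Lemma is_series_near (u : nat -> C) (l v : C) (e : R) (M0 : nat) :
  is_series u l -> (forall M, (M0 <= M)%nat -> Cmod (csum u M - v)%C <= e) -> Cmod (l - v)%C <= e.
Proof.
  intros Hl HM. apply le_epsilon. intros eta Heta.
  destruct (proj1 (filterlim_locally_ball_norm (K := C_AbsRing) (sum_n u) l) Hl (mkposreal eta Heta)) as [N HN].
  specialize (HN (N + M0)%nat ltac:(lia)). unfold ball_norm in HN.
  change (Cmod (sum_n u (N + M0) - l)%C < eta) in HN. rewrite sum_n_csum in HN.
  specialize (HM (S (N + M0)) ltac:(lia)).
  pose proof (Cmod_triangle (l - csum u (S (N + M0))) (csum u (S (N + M0)) - v)) as H.
  rewrite (Cmod_minus_sym l) in H.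
  replace (l - csum u (S (N + M0)) + (csum u (S (N + M0)) - v))%C with (l - v)%C in H by ring. lra.
Qed.

Lemma pow_n_Cpow (z : C) k : pow_n z k = (z ^ k)%C.
Proof. induction k as [|k IH]; [reflexivity|]. simpl. now rewrite IH. Qed.

(** Stage i is altered with s = r (n i), the very radius at which it approximates its own target for
    i > 0, so each approximation survives the later changes. *)
Lemma dominating_sequence (gamma r : nat -> R) :
  (forall k, 0 < gamma k) -> subexponential gamma -> admissible_radii r ->
  exists (A : nat -> nat -> C) (n N : nat -> nat),
    (forall i, dominating gamma (A i)) /\ (forall i, (n i < n (S i))%nat) /\
    (forall i, (N i < N (S i))%nat) /\
    (forall i k, (k <= N (S i))%nat -> A (S i) k = A i k) /\
    (forall i m, rsum (fun k => Cmod (A (S i) k - A i k)%C * r (n i) ^ k) m <= (1 / 2) ^ i) /\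
    (forall i, exists M0, forall M, (M0 <= M)%nat ->
      forall zeta, arc (task_gap i) (task_width i) zeta ->
      Cmod (csum (fun k => A (S i) k * (RtoC (r (n (S i))) * zeta) ^ k)%C M
            - eval (task_target i) zeta)%C <= (1 / 2) ^ i).
Proof.
  intros Hg Hsub Hr.
  pose (St := { a : nat -> C | dominating gamma a }).
  assert (step : forall (i : nat) (s : St * nat * nat), { t : St * nat * nat |
    (snd (fst s) < snd (fst t))%nat /\ (snd s < snd t)%nat /\
    (forall k, (k <= snd t)%nat -> proj1_sig (fst (fst t)) k = proj1_sig (fst (fst s)) k) /\
    (forall m, rsum (fun k => Cmod (proj1_sig (fst (fst t)) k - proj1_sig (fst (fst s)) k)%C
                              * r (snd (fst s)) ^ k) m <= (1 / 2) ^ i) /\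
    (exists M0, forall M, (M0 <= M)%nat ->
      forall zeta, arc (task_gap i) (task_width i) zeta ->
      Cmod (csum (fun k => proj1_sig (fst (fst t)) k * (RtoC (r (snd (fst t))) * zeta) ^ k)%C M
            - eval (task_target i) zeta)%C <= (1 / 2) ^ i) }).
  { intros i [[[a Ha] n0] N0]. apply constructive_indefinite_description. simpl.
    destruct (approximation_step gamma r a (task_gap i) (task_width i) (r n0) ((1 / 2) ^ i)
      (task_target i) n0 N0 Hg Hsub Hr Ha (Cmod_normalize _) (task_width_bounds i)
      (proj1 Hr n0) ltac:(apply pow_lt; lra)) as [a' [n [N [H1 [H2 [H3 [H4 [H5 H6]]]]]]]].
    exists (exist _ a' H1, n, N). simpl. repeat split; assumption. }
  assert (Hinit : dominating gamma (fun k => RtoC (gamma k))).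
  { assert (E : forall k, Cmod (RtoC (gamma k)) = gamma k).
    { intros k. rewrite Cmod_R. apply Rabs_pos_eq. left; apply Hg. }
    split; [intros k; rewrite E; lra|]. exists O. intros k _. rewrite E; lra. }
  pose (seq := fix seq (i : nat) : St * nat * nat :=
    match i with O => (exist _ _ Hinit, O, O) | S i => proj1_sig (step i (seq i)) end).
  exists (fun i => proj1_sig (fst (fst (seq i)))), (fun i => snd (fst (seq i))), (fun i => snd (seq i)).
  split; [intros i; apply proj2_sig|].
  repeat split; intros i; pose proof (proj2_sig (step i (seq i))) as [H1 [H2 [H3 [H4 H5]]]];
    assumption.
Qed.

Lemma increasing_choice (P : nat -> nat -> Prop) :
  (forall k i0, exists i, (i0 <= i)%nat /\ P k i) ->
  exists f : nat -> nat, (forall k, (f k < f (S k))%nat) /\ forall k, P k (f k).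
Proof.
  intros H.
  pose (sel := fun k i0 => constructive_indefinite_description _ (H k i0)).
  pose (f := fix f (k : nat) : nat :=
    match k with O => proj1_sig (sel O O) | S k => proj1_sig (sel (S k) (S (f k))) end).
  exists f. split.
  - intros k. simpl. destruct (proj2_sig (sel (S k) (S (f k)))) as [H1 _]. exact H1.
  - intros [|k]; simpl; apply (proj2_sig (sel _ _)).
Qed.

Lemma strictly_increasing_ge (n : nat -> nat) :
  (forall i, (n i < n (S i))%nat) -> forall i, (i <= n i)%nat.
Proof. intros H; induction i as [|i IH]; [lia|]. specialize (H i). lia. Qed.

Lemma radii_mono (r : nat -> R) : admissible_radii r -> forall i j, (i <= j)%nat -> r i <= r j.
Proof.
  intros [_ [H _]] i j Hij. induction Hij as [|j Hij IH]; [lra|]. specialize (H j). lra.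
Qed.

Lemma universal_function (gamma r : nat -> R) :
  (forall k, 0 < gamma k) -> subexponential gamma -> admissible_radii r ->
  exists (a : nat -> C) (f : C -> C), taylor_on_disc a f /\ abel_universal_rho r f /\
    forall k, gamma k <= Cmod (a k).
Proof.
  intros Hg Hsub Hr.
  destruct (dominating_sequence gamma r Hg Hsub Hr) as [A [n [N [HA [Hn [HN [Hfix [Hclose Happ]]]]]]]].
  (* Since N i >= i, the k-th coefficient is final from stage k on. *)
  set (a := fun k => A k k).
  assert (HNi : forall i, (i <= N i)%nat) by now apply strictly_increasing_ge.
  assert (Hni : forall i, (i <= n i)%nat) by now apply strictly_increasing_ge.
  assert (Hnm : forall i j, (i <= j)%nat -> (n i <= n j)%nat).
  { intros i j Hij. induction Hij as [|j Hij IH]; [lia|]. specialize (Hn j). lia. }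
  assert (Hstab : forall k j, (k <= j)%nat -> A j k = a k).
  { intros k j Hkj. induction Hkj as [|j Hkj IH]; [reflexivity|].
    rewrite Hfix; [exact IH|]. specialize (HNi (S j)). lia. }
  pose proof (proj1 Hr) as Hr01.
  (* Telescoping over the stages: the change at stage j is measured at a radius no smaller than r (n
     i), and the powers of 1/2 sum to 2 (1/2)^i. For the first m terms stage i + m already coincides
     with the limit. *)
  assert (Hdist : forall i m, rsum (fun k => Cmod (a k - A i k)%C * r (n i) ^ k) m <= 2 * (1 / 2) ^ i).
  { intros i m.
    assert (E : forall p, rsum (fun k => Cmod (A (i + p)%nat k - A i k)%C * r (n i) ^ k) m
                          <= 2 * (1 / 2) ^ i - 2 * (1 / 2) ^ (i + p)).
    { induction p as [|p IH].
      - rewrite Nat.add_0_r. rewrite (rsum_ext _ (fun _ => 0 * 0)).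
        + rewrite rsum_scal. lra.
        + intros k _. replace (A i k - A i k)%C with (RtoC 0) by ring. rewrite Cmod_0. ring.
      - replace (i + S p)%nat with (S (i + p)) by lia.
        apply Rle_trans with (rsum (fun k => Cmod (A (S (i + p)) k - A (i + p)%nat k)%C * r (n (i + p)%nat) ^ k
          + Cmod (A (i + p)%nat k - A i k)%C * r (n i) ^ k) m).
        + apply rsum_le. intros k _.
          pose proof (Cmod_triangle (A (S (i + p)) k - A (i + p)%nat k) (A (i + p)%nat k - A i k)) as H.
          replace (A (S (i + p)) k - A (i + p)%nat k + (A (i + p)%nat k - A i k))%C
            with (A (S (i + p)) k - A i k)%C in H by ring.
          assert (Hp : 0 <= r (n i) ^ k <= r (n (i + p)%nat) ^ k).
          { split; [apply pow_le, Hr01|]. apply pow_incr. split; [apply Hr01|].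
            apply radii_mono; [exact Hr|]. apply Hnm. lia. }
          pose proof (Cmod_ge_0 (A (S (i + p)) k - A (i + p)%nat k)).
          pose proof (Cmod_ge_0 (A (i + p)%nat k - A i k)). nra.
        + rewrite rsum_plus. specialize (Hclose (i + p)%nat m). simpl pow. lra. }
    specialize (E m). assert (0 <= (1 / 2) ^ (i + m)) by (apply pow_le; lra).
    rewrite (rsum_ext _ (fun k => Cmod (A (i + m)%nat k - A i k)%C * r (n i) ^ k)); [lra|].
    intros k Hk. now rewrite (Hstab k (i + m)%nat) by lia. }
  assert (Hconv : forall z, Cmod z < 1 -> ex_series (fun k => (a k * pow_n z k)%C)).
  { intros z Hz. destruct (radii_near_one r (Cmod z) O Hr Hz) as [i [_ Hi]].
    assert (Hri : Cmod z < r (n i)).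
    { eapply Rlt_le_trans; [exact Hi|]. apply radii_mono; [exact Hr|apply Hni]. }
    destruct (Hr01 (n i)) as [_ Hr1]. set (R0 := r (n i)) in *. pose proof (Cmod_ge_0 z) as Hz0.
    set (lam := / R0). assert (Hlam : 1 < lam).
    { unfold lam. rewrite <- Rinv_1. apply Rinv_lt_contravar; lra. }
    destruct (Hsub lam Hlam) as [N1 HN1]. destruct (proj2 (HA i)) as [N2 HN2].
    (* |a_k| R0^k is at most 2 from the distance to stage i, plus 1 from that stage itself, whose
       coefficients are eventually at most R0^(-k). *)
    apply ex_series_geometric_bound with (c := 3) (x := Cmod z / R0) (N := (N1 + N2)%nat).
    { split; [apply Rdiv_le_0_compat; lra|apply Rlt_div_l; lra]. }
    intros k Hk. rewrite pow_n_Cpow, Cmod_mult, Cmod_pow.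
    specialize (HN1 k ltac:(lia)). specialize (HN2 k ltac:(lia)).
    assert (HRk : 0 < R0 ^ k) by (apply pow_lt; lra).
    assert (Hzk : 0 <= Cmod z ^ k) by (apply pow_le; lra).
    assert (Hd : Cmod (a k - A i k) * R0 ^ k <= 2).
    { eapply Rle_trans; [apply (rsum_term_le (fun k => Cmod (a k - A i k)%C * R0 ^ k) (S k) k)|].
      - intros j. apply Rmult_le_pos; [apply Cmod_ge_0|apply pow_le; lra].
      - lia.
      - eapply Rle_trans; [apply Hdist|].
        assert (Hi2 : (1 / 2) ^ i <= 1 ^ i) by (apply pow_incr; lra).
        rewrite pow1 in Hi2. lra. }
    assert (Hak : Cmod (a k) * R0 ^ k <= 3).
    { pose proof (Cmod_sub_ge (a k) (A i k)).
      assert (lam ^ k * R0 ^ k = 1).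
      { unfold lam. rewrite <- Rpow_mult_distr, Rinv_l by lra. apply pow1. }
      assert (Cmod (A i k) * R0 ^ k <= lam ^ k * R0 ^ k) by (apply Rmult_le_compat_r; lra).
      nra. }
    unfold Rdiv. rewrite Rpow_mult_distr, pow_inv.
    apply Rmult_le_reg_r with (R0 ^ k); [exact HRk|].
    replace (3 * (Cmod z ^ k * / R0 ^ k) * R0 ^ k) with (3 * Cmod z ^ k) by (field; lra). nra. }
  set (f := fun z => match excluded_middle_informative (Cmod z < 1) with
    | left H => proj1_sig (constructive_indefinite_description _ (Hconv z H))
    | right _ => RtoC 0 end).
  assert (Hf : taylor_on_disc a f).
  { intros z Hz. unfold f. destruct excluded_middle_informative as [H|H]; [|easy].
    now destruct constructive_indefinite_description. }
  clearbody f. exists a, f. split; [exact Hf|]. split; [|intros k; apply (HA k)].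
  intros K phi HKc HK [z0 [Hz0 HKz0]] Hphi.
  destruct (compact_distance K z0 HK HKz0) as [delta [Hd Hdelta]].
  destruct (increasing_choice (fun k i => forall zeta, K zeta ->
    Cmod (dil f (r (n (S i))) zeta - phi zeta)%C <= / INR (S k))) as [g [Hg1 Hg2]].
  - intros k i0. set (e := / INR (S k)).
    assert (He : 0 < e) by (apply Rinv_0_lt_compat, lt_0_INR; lia).
    destruct (weierstrass_arc K phi z0 (e / 4) HKc HK Hz0 HKz0 Hphi ltac:(lra)) as [T HT].
    destruct (pow_eventually_small (1 / 2) (e / 4) ltac:(lra) ltac:(lra)) as [i1 Hi1].
    (* Error budget: e/4 from phi to T, e/4 from T to the coded target, and 2 (1/2)^i <= e/2 from
       the target to f. *)
    destruct (task_dense z0 delta T (e / 4) (i0 + i1) Hz0 Hd ltac:(lra)) as [i [Hi [Harc Htgt]]].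
    exists i. split; [lia|]. intros zeta Hzeta. specialize (Hi1 i ltac:(lia)).
    pose proof (HKc zeta Hzeta) as Hz1. red in Hz1.
    assert (Hza : arc (task_gap i) (task_width i) zeta).
    { apply Harc. split; [exact Hz1|now apply Hdelta]. }
    destruct (Happ i) as [M0 HM0].
    set (R0 := r (n (S i))) in *. set (z := (RtoC R0 * zeta)%C).
    destruct (Hr01 (n (S i))) as [Hr0 Hr1]. fold R0 in Hr0, Hr1.
    assert (Hzm : Cmod z = R0) by (unfold z; rewrite Cmod_mult, Cmod_R, Hz1, Rabs_pos_eq; lra).
    assert (Hlim : Cmod (f z - eval (task_target i) zeta)%C <= 2 * (1 / 2) ^ i).
    { apply is_series_near with (u := fun k => (a k * pow_n z k)%C) (M0 := M0); [apply Hf; lra|].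
      intros M HM. specialize (HM0 M HM zeta Hza). fold z in HM0.
      rewrite (csum_ext _ (fun k => a k * z ^ k)%C) by (intros; now rewrite pow_n_Cpow).
      set (S1 := csum (fun k => A (S i) k * z ^ k)%C M) in *.
      replace (csum (fun k => a k * z ^ k)%C M)
        with (S1 + csum (fun k => (a k - A (S i) k) * z ^ k)%C M)%C.
      2:{ unfold S1. rewrite <- csum_plus. apply csum_ext. intros; ring. }
      set (S2 := csum (fun k => (a k - A (S i) k) * z ^ k)%C M).
      assert (HS2 : Cmod S2 <= 2 * (1 / 2) ^ S i).
      { eapply Rle_trans; [apply Cmod_csum|]. eapply Rle_trans; [|apply (Hdist (S i) M)].
        apply rsum_le. intros j _. rewrite Cmod_mult, Cmod_pow, Hzm. right. reflexivity. }
      replace (S1 + S2 - eval (task_target i) zeta)%C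
        with ((S1 - eval (task_target i) zeta) + S2)%C by ring.
      eapply Rle_trans; [apply Cmod_triangle|]. simpl pow in HS2. lra. }
    specialize (Htgt zeta ltac:(lra)). specialize (HT zeta Hzeta). unfold dil. fold z.
    pose proof (Cmod_triangle (f z - eval (task_target i) zeta)
      ((eval (task_target i) zeta - eval T zeta) + (eval T zeta - phi zeta))) as H1.
    pose proof (Cmod_triangle (eval (task_target i) zeta - eval T zeta) (eval T zeta - phi zeta)) as H2.
    replace (f z - eval (task_target i) zeta + (eval (task_target i) zeta - eval T zeta
      + (eval T zeta - phi zeta)))%C with (f z - phi zeta)%C in H1 by ring. lra.
  - exists (fun k => n (S (g k))). split.
    + intros k. specialize (Hg1 k). specialize (Hn (S (g k))).
      pose proof (Hnm (S (S (g k))) (S (g (S k))) ltac:(lia)). lia.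
    + intros eps He. destruct (archimed_cor1 eps He) as [k0 [Hk0 Hk00]]. exists k0.
      intros k Hk zeta Hzeta. eapply Rle_trans; [now apply Hg2|].
      eapply Rle_trans; [|left; exact Hk0].
      apply Rinv_le_contravar; [apply lt_0_INR; lia|apply le_INR; lia].
Qed.

(** * Exclusion of Hadamard-Ostrowski gaps *)

Lemma kroot_ge_1 (x : R) (k : nat) : 1 <= x -> 1 <= kroot x k.
Proof.
  intros Hx. unfold kroot. destruct Req_EM_T; [lra|].
  destruct (Nat.eq_dec k 0) as [->|Hk].
  (* At k = 0 the convention / 0 = 0 makes the root equal to 1. *)
  - simpl INR. rewrite Rinv_0, Rpower_O; lra.
  - rewrite <- (Rpower_O x) at 1 by lra. apply Rle_Rpower; [exact Hx|].
    left. apply Rinv_0_lt_compat, lt_0_INR. lia.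
Qed.

(** The right end q_N of the N-th gap block is itself in the block and exceeds N, so the root of
    |a_(q_N)| would be at most c < 1 and at least 1. *)
Lemma not_HO_gaps_of_coef_ge_1 (a : nat -> C) : (forall k, 1 <= Cmod (a k)) -> ~ HO_gaps a.
Proof.
  intros Ha [_ [p [q [_ [Hpq [_ [c [Hc [N HN]]]]]]]]].
  assert (Hp : forall k, (k <= p k)%nat).
  { induction k as [|k IH]; [lia|]. specialize (Hpq k). lia. }
  specialize (HN (q N)). specialize (Hpq N) as [H1 _]. specialize (Hp N).
  pose proof (kroot_ge_1 (Cmod (a (q N))) (q N) (Ha _)).
  assert (kroot (Cmod (a (q N))) (q N) <= c); [|lra].
  apply HN; [lia|]. exists N. lia.
Qed.

Lemma harmonic_radii : admissible_radii (fun n => 1 - / INR (S n)).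
Proof.
  assert (Hp : forall n, 0 < INR (S n)) by (intros; apply lt_0_INR; lia).
  split; [|split].
  - intros n. split; [|pose proof (Rinv_0_lt_compat _ (Hp n)); lra].
    assert (/ INR (S n) <= 1); [|lra]. rewrite <- Rinv_1.
    apply Rinv_le_contravar; [lra|]. rewrite S_INR. pose proof (pos_INR n). lra.
  - intros n. assert (/ INR (S (S n)) < / INR (S n)); [|lra].
    apply Rinv_lt_contravar; [now apply Rmult_lt_0_compat|]. apply lt_INR; lia.
  - apply is_lim_seq_spec. intros eps.
    destruct (archimed_cor1 eps (cond_pos eps)) as [N [HN HN0]]. exists N. intros n Hn.
    replace (1 - / INR (S n) - 1) with (- / INR (S n)) by ring.
    rewrite Rabs_Ropp, Rabs_pos_eq by (left; now apply Rinv_0_lt_compat).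
    eapply Rle_lt_trans; [|exact HN]. apply Rinv_le_contravar; [apply lt_0_INR; lia|apply le_INR; lia].
Qed.

Theorem theorem4p5 :
  (forall (r : nat -> R) (gamma : nat -> R),
     admissible_radii r ->
     (forall k, 0 < gamma k) ->
     Rbar_le (LimSup_seq (fun k => kroot (gamma k) k)) 1 ->
     exists (a : nat -> C) (f : C -> C),
       taylor_on_disc a f /\ abel_universal_rho r f /\
       exists N, forall k, (N <= k)%nat -> gamma k <= Cmod (a k))
  /\
  (exists (a : nat -> C) (f : C -> C), abel_universal a f /\ ~ HO_gaps a).
Proof.
  split.
  - intros r gamma Hr Hg HL.
    destruct (universal_function gamma r Hg (subexponential_of_kroot gamma Hg HL) Hr)
      as [a [f [H1 [H2 H3]]]].
    exists a, f. split; [exact H1|]. split; [exact H2|]. now exists O.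
  (* The constant sequence 1 is admissible and forces every coefficient to have modulus at least
     1. *)
  - assert (Hsub : subexponential (fun _ => 1)).
    { intros lam Hlam. exists O. intros k _. apply pow_ge_1. lra. }
    destruct (universal_function (fun _ => 1) _ (fun _ => Rlt_0_1) Hsub harmonic_radii)
      as [a [f [H1 [H2 H3]]]].
    exists a, f. split; [|now apply not_HO_gaps_of_coef_ge_1].
    split; [exact H1|]. eexists; split; [apply harmonic_radii|exact H2].
Qed.
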